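(* Let $(V,\bullet,\odot,1,\partial)$ be a 2-associative differential algebra over a field $\mathbb K$. Let $\tau^{\odot}_1\colon \overline T^c(V)\to V$ be the linear map whose restriction to $V^{\otimes n}$ is the iterated multiplication $\odot^{(n-1)}\colon V^{\otimes n}\to V$, $v_1\otimes\cdots\otimes v_n\mapsto v_1\odot\cdots\odot v_n$, for every $n\ge 1$. Then there is a unique $B_\infty$ structure $(\mu,d)=(\mu_{\bullet}^{\odot},d_{\partial}^{\odot})$ on the graded vector space $V$ such that $$\tau^{\odot}_1\circ \mu=\bullet\circ(\tau^{\odot}_1\otimes\tau^{\odot}_1)\colon \overline T^c(V)\otimes\overline T^c(V)\to V,\qquad \tau^{\odot}_1\circ d=\partial\circ\tau^{\odot}_1\colon \overline T^c(V)\to V .$$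
   Context: Conventions. Vector spaces are $\mathbb Z$-graded over a field $\mathbb K$; maps have degree $0$ unless stated otherwise; the Koszul sign rule is used: $(f\otimes g)(a\otimes b)=(-1)^{|g||a|}f(a)\otimes g(b)$ and the symmetry is $a\otimes b\mapsto(-1)^{|a||b|}b\otimes a$. Tensor coalgebra. $T^c(V)=\bigoplus_{k\ge0}V^{\otimes k}$ is the coalgebra with deconcatenation $\Delta(v_1\cdots v_k)=\sum_{i=0}^k v_1\cdots v_i\otimes v_{i+1}\cdots v_k$, counit $\varepsilon$ the projection to $V^{\otimes0}=\mathbb K$, and unit $1=1_{\mathbb K}\in V^{\otimes 0}$. Write $\overline T^c(V)=\ker\varepsilon=\bigoplus_{k\ge1}V^{\otimes k}$. The coalgebra $T^c(V)\otimes T^c(V)$ has comultiplication $(23)(\Delta\otimes\Delta)$ and counit $\varepsilon\otimes\varepsilon$. $B_\infty$ structure (in the shifted convention). A $B_\infty$ structure on a graded vector space $V$ is a pair $(\mu,d)$ where $\mu\colon T^c(V)\otimes T^c(V)\to T^c(V)$ is a coalgebra map of degree $0$ that is associative and satisfies $\mu(1\otimes x)=x=\mu(x\otimes1)$, and $d\colon T^c(V)\to T^c(V)$ is a coderivation ($\Delta d=(d\otimes\mathrm{id}+\mathrm{id}\otimes d)\Delta$) of degree $-1$ with $d(1)=0$, $d^2=0$, and $d\mu=\mu(d\otimes\mathrm{id}+\mathrm{id}\otimes d)$. For such a structure $\mu$ maps $\overline T^c(V)\otimes\overline T^c(V)$ into $\overline T^c(V)$ and $d$ maps $\overline T^c(V)$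 into itself. 2-associative differential algebra. This is a differential graded algebra $(V,\bullet,1,\partial)$ (a unital associative graded algebra with a map $\partial$ of degree $-1$, $\partial^2=0$, that is a derivation of $\bullet$) together with a second associative binary operation $\odot$ on $V$ (of degree $0$) with the same unit $1$; no further compatibility of $\odot$ with $\bullet$ or $\partial$ is required. *)

(* Defs.v *)
From HB Require Import structures.
From mathcomp Require Import all_boot ssralg ssrint.
From mathcomp Require Import generic_quotient ring_quotient finmap.
From mathcomp Require Import boolp classical_sets functions cardinality fsbigop.
From mathcomp Require Import monalg.

Set Implicit Arguments.
Unset Strict Implicit.
Unset Printing Implicit Defensive.

Import GRing.Theory.

Local Open Scope ring_scope.
Local Open Scope quotient_scope.
Local Open Scope classical_set_scope.

Reserved Notation "x \ox y" (at level 40, left associativity).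

Section FreeExtension.
Variables (K : fieldType) (X : choiceType) (M : lmodType K).

Definition fext (f : X -> M) (g : {malg K[X]}) : M :=
  \sum_(k <- msupp g) g@_k *: f k.

Lemma fextEw (f : X -> M) (g : {malg K[X]}) (s : {fset X}) :
  {subset msupp g <= s} -> fext f g = \sum_(k <- s) g@_k *: f k.
Proof.
move=> gs; apply: big_fset_incl; first exact/fsubsetP.
by move=> x _ /mcoeff_outdom ->; rewrite scale0r.
Qed.

Lemma fext_linear (f : X -> M) : linear (fext f).
Proof.
move=> a u v; pose s := fsetU (msupp u) (msupp v).
have su : {subset msupp u <= s} by move=> x xu; rewrite in_fsetU xu.
have sv : {subset msupp v <= s} by move=> x xv; rewrite in_fsetU xv orbT.
have suv : {subset msupp (a *: u + v) <= s}.
  move=> x; rewrite -mcoeff_neq0 mcoeffD mcoeffZ in_fsetU.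
  by case: (msuppP u x); case: (msuppP v x) => //; rewrite mulr0 addr0 eqxx.
rewrite (fextEw f su) (fextEw f sv) (fextEw f suv) scaler_sumr -big_split.
by apply: eq_bigr => x _; rewrite mcoeffD mcoeffZ scalerDl scalerA.
Qed.
HB.instance Definition _ f :=
  GRing.isLinear.Build K _ _ _ (fext f) (fext_linear f).

Lemma fextU (f : X -> M) (x : X) : fext f << x >> = f x.
Proof.
by rewrite /fext msuppU oner_eq0 big_seq_fset1 mcoeffUU scale1r.
Qed.

End FreeExtension.

(* The module with generators X and relations r = 0 for r in R. *)
Record presentation (K : fieldType) (X : choiceType) (R : set {malg K[X]}) := {
  pres_mod : lmodType K;
  pres_gen : X -> pres_mod;
  pres_rel : forall r, R r -> fext pres_gen r = 0;
  pres_univ : forall (M : lmodType K) (f : X -> M),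
    (forall r, R r -> fext f r = 0) ->
    exists g : {linear pres_mod -> M}, forall x, g (pres_gen x) = f x;
  pres_ind : forall P : pres_mod -> Prop,
    P 0 -> (forall a x y, P x -> P y -> P (a *: x + y)) ->
    (forall x, P (pres_gen x)) -> forall x, P x
}.

Module FreeQuotient.
Section FreeQuotient.
Variables (K : fieldType) (X : choiceType) (R : set {malg K[X]}).

Definition relspan : {pred {malg K[X]}} := fun g =>
  `[< forall S : {pred {malg K[X]}},
        submod_closed S -> (forall r, R r -> r \in S) -> g \in S >].

Lemma relspanP : submod_closed relspan.
Proof.
split=> [|a u v /asboolP uS /asboolP vS]; apply/asboolP => S clS RS.
  by case: clS.
by case: (clS) => _; apply; [exact: uS | exact: vS].
Qed.

HB.instance Definition _ :=
  GRing.isZmodClosed.Build {malg K[X]} relspan (GRing.submod_closedB relspanP).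

Definition quot : Type := Quotient.quot relspan.
HB.instance Definition _ := GRing.Zmodule.on quot.
HB.instance Definition _ := Quotient.on quot.

Definition cls (g : {malg K[X]}) : quot := \pi_(quot) g.

Lemma cls_surj (x : quot) : exists g, x = cls g.
Proof. by exists (repr x); rewrite /cls reprK. Qed.

Lemma cls_zmod : zmod_morphism cls.
Proof. by move=> x y; rewrite /cls raddfB. Qed.
HB.instance Definition _ := GRing.isZmodMorphism.Build _ _ cls cls_zmod.

Lemma cls_eq g h : (cls g == cls h) = (g - h \in relspan).
Proof. by rewrite Quotient.idealrBE. Qed.

Definition scale (a : K) (x : quot) : quot := cls (a *: repr x).

Lemma scaleE a g : scale a (cls g) = cls (a *: g).
Proof.
apply/eqP; rewrite cls_eq -scalerBr; have [r0 rS] := relspanP.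
rewrite -[_ *: _]addr0; apply: rS => //.
by rewrite -cls_eq /cls reprK.
Qed.

Fact scaleA a b x : scale a (scale b x) = scale (a * b) x.
Proof. by have [g ->] := cls_surj x; rewrite !scaleE scalerA. Qed.
Fact scale1 : left_id 1 scale.
Proof. by move=> x; have [g ->] := cls_surj x; rewrite scaleE scale1r. Qed.
Fact scaleDr : right_distributive scale +%R.
Proof.
move=> a x y; have [[g ->] [h ->]] := (cls_surj x, cls_surj y).
by rewrite -raddfD !scaleE scalerDr raddfD.
Qed.
Fact scaleDl x : {morph scale^~ x : a b / a + b >-> a + b}.
Proof.
move=> a b; have [g ->] := cls_surj x.
by rewrite !scaleE scalerDl raddfD.
Qed.
HB.instance Definition _ := GRing.Zmodule_isLmodule.Build K quot
  scaleA scale1 scaleDr scaleDl.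

Lemma cls_scalable : scalable cls.
Proof. by move=> a g; rewrite -scaleE. Qed.
HB.instance Definition _ := GRing.isScalable.Build K _ _ _ cls cls_scalable.

Definition gen (x : X) : quot := cls << x >>.

Let mkmalgUZ (a : K) x : << a *g x >> = a *: << x >> :> {malg K[X]}.
Proof. by apply/malgP=> j; rewrite mcoeffZ !mcoeffU mulrnAr mulr1. Qed.

Lemma clsE g : cls g = fext gen g.
Proof.
rewrite [in LHS](monalgE g) raddf_sum; apply: eq_bigr => x _ /=.
by rewrite mkmalgUZ linearZ.
Qed.

Lemma rel r : R r -> fext gen r = 0.
Proof.
move=> Rr; rewrite -clsE; apply/eqP; rewrite -(raddf0 cls) cls_eq subr0.
by apply/asboolP => S _; apply.
Qed.

Lemma ind (P : quot -> Prop) :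
    P 0 -> (forall a x y, P x -> P y -> P (a *: x + y)) ->
  (forall x, P (gen x)) -> forall x, P x.
Proof.
move=> P0 PD Pg x; have [g ->] := cls_surj x; rewrite clsE.
rewrite /fext; elim/big_ind: _ => // [u v Pu Pv|k _]; first by rewrite -[u]scale1r; apply: PD.
by rewrite -[_ *: _]addr0; apply: PD.
Qed.

Lemma univ (M : lmodType K) (f : X -> M) : (forall r, R r -> fext f r = 0) ->
  exists g : {linear quot -> M}, forall x, g (gen x) = f x.
Proof.
move=> fR; pose h (x : quot) : M := fext f (repr x).
have hE g : h (cls g) = fext f g.
  apply/eqP; rewrite -subr_eq0 -linearB.
  have : repr (cls g) - g \in relspan by rewrite -cls_eq /cls reprK.
  move=> /asboolP /(_ [pred u | fext f u == 0]); apply.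
    split=> [|a u v]; first by rewrite inE linear0.
    by rewrite !inE => /eqP fu /eqP fv; rewrite linearP /= fu fv scaler0 addr0.
  by move=> r /fR fr; rewrite inE fr.
have lh : linear h.
  move=> a x y; have [[u ->] [v ->]] := (cls_surj x, cls_surj y).
  by rewrite -linearP !hE linearP.
pose h' : {linear _ -> _} := HB.pack h (GRing.isLinear.Build K _ _ _ h lh).
by exists h' => x; rewrite /h' /= hE fextU.
Qed.

Definition pres : presentation R :=
  @Build_presentation K X R quot gen rel univ ind.

End FreeQuotient.
End FreeQuotient.

(* The free module on X modulo the submodule spanned by R. *)
HB.lock Definition free_quotient (K : fieldType) (X : choiceType)
    (R : set {malg K[X]}) : presentation R :=
  FreeQuotient.pres R.

Section Presented.
Variables (K : fieldType) (X : choiceType) (R : set {malg K[X]}).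

Definition presmod : lmodType K := pres_mod (free_quotient R).

Definition gen : X -> presmod := pres_gen (free_quotient R).

Lemma presmod_ind (P : presmod -> Prop) :
    P 0 -> (forall a x y, P x -> P y -> P (a *: x + y)) ->
  (forall x, P (gen x)) -> forall x, P x.
Proof. exact: pres_ind. Qed.

Lemma gen_rel (k : K) x y z :
  R (<< x >> - (k *: << y >> + << z >>)) -> gen x = k *: gen y + gen z.
Proof.
move=> /(pres_rel (free_quotient R)); rewrite linearB linearP /= !fextU.
by move/eqP; rewrite subr_eq0 => /eqP.
Qed.

Variable M : lmodType K.

Lemma presmod_ext (f g : presmod -> M) : linear f -> linear g ->
  (forall x, f (gen x) = g (gen x)) -> f =1 g.
Proof.
move=> lf lg fg.
have l0 (h : presmod -> M) : linear h -> h 0 = 0.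
  by move=> lh; have := lh (-1) 0 0; rewrite !scaleN1r oppr0 addr0 addNr.
apply: presmod_ind => // [|a x y fx fy]; first by rewrite !l0.
by rewrite lf lg fx fy.
Qed.

(* The linear map with prescribed values on the generators; by convention it
   is 0 when the prescribed values do not satisfy the relations. *)
Definition lift (f : X -> M) : {linear presmod -> M} :=
  if pselect (exists g : {linear presmod -> M}, forall x, g (gen x) = f x)
    is left e then projT1 (cid e) else \0.

Lemma liftE (f : X -> M) : (forall r, R r -> fext f r = 0) ->
  forall x, lift f (gen x) = f x.
Proof.
move=> /pres_univ - /(_ (free_quotient R)) e; rewrite /lift.
by case: pselect => // e'; case: cid.
Qed.

End Presented.

Definition bilinear2 (K : fieldType) (A B C : lmodType K) (f : A -> B -> C) :=
  (forall b, linear (f^~ b)) /\ (forall a, linear (f a)).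

Section Tensor.
Variables (K : fieldType) (A B : lmodType K).

(* Tensor product of vector spaces, presented by the pairs (a, b) subject to
   bilinearity. *)
Inductive tensor_rel : set {malg K[(A * B)%type]} :=
| tensor_rel_l (k : K) (x y : A) (b : B) :
    tensor_rel (<< (k *: x + y, b) >> - (k *: << (x, b) >> + << (y, b) >>))
| tensor_rel_r (k : K) (a : A) (x y : B) :
    tensor_rel (<< (a, k *: x + y) >> - (k *: << (a, x) >> + << (a, y) >>)).

Definition tensor : Type := presmod tensor_rel.
HB.instance Definition _ := GRing.Lmodule.on tensor.

Definition tens (a : A) (b : B) : tensor := gen tensor_rel (a, b).

End Tensor.

Notation "x \ox y" := (tens x y) : ring_scope.

Section TensorTheory.
Variables (K : fieldType) (A B M : lmodType K).
Implicit Types f : A -> B -> M.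

Lemma tens_bilinear : bilinear2 (@tens K A B).
Proof.
split=> [b k x y|a k x y]; apply: gen_rel.
  exact: tensor_rel_l.
exact: tensor_rel_r.
Qed.

Lemma tens_linearl b : linear (fun a : A => a \ox b : tensor A B).
Proof. exact: tens_bilinear.1. Qed.

Lemma tens_linearr a : linear (fun b : B => a \ox b : tensor A B).
Proof. exact: tens_bilinear.2. Qed.

(* The linear map a \ox b |-> f a b, for bilinear f. *)
Definition lift2 f : {linear tensor A B -> M} :=
  @lift K _ (@tensor_rel K A B) M (fun p => f p.1 p.2).

Lemma lift2E f : bilinear2 f -> forall a b, lift2 f (a \ox b) = f a b.
Proof.
move=> [fl fr] a b; rewrite /lift2 /tens liftE // => r [] *.
  by rewrite linearB linearP /= !fextU /= fl subrr.
by rewrite linearB linearP /= !fextU /= fr subrr.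
Qed.

Lemma tensor_ind (P : tensor A B -> Prop) :
    P 0 -> (forall a x y, P x -> P y -> P (a *: x + y)) ->
  (forall a b, P (a \ox b)) -> forall x, P x.
Proof. by move=> P0 PD Pg; apply: presmod_ind => // -[a b]; apply: Pg. Qed.

Lemma tensor_ext (f g : tensor A B -> M) : linear f -> linear g ->
  (forall a b, f (a \ox b) = g (a \ox b)) -> f =1 g.
Proof. by move=> lf lg fg; apply: presmod_ext => // -[a b]; apply: fg. Qed.

End TensorTheory.

(* Z-graded vector spaces, as a space V with the projections onto its
   homogeneous components V_i: x lies in V_i iff hproj i x = x. *)
HB.mixin Record isGraded (K : fieldType) V of GRing.Lmodule K V := {
  hproj : int -> V -> V;
  hproj_linear : forall i, linear (hproj i);
  hproj_hproj : forall i j x,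
    hproj i (hproj j x) = if i == j then hproj j x else 0;
  hproj_finite : forall x, finite_set [set i | hproj i x != 0];
  hproj_sum : forall x, \sum_(i \in [set: int]) hproj i x = x
}.

#[short(type="gradedModType")]
HB.structure Definition GradedModule (K : fieldType) :=
  {V of isGraded K V & GRing.Lmodule K V}.

HB.instance Definition _ (K : fieldType) (V : gradedModType K) i :=
  GRing.isLinear.Build K _ _ _ (@hproj K V i) (@hproj_linear K V i).

Definition homog (K : fieldType) (V : gradedModType K) (n : int) (x : V) :=
  hproj n x = x.

Definition has_degree (K : fieldType) (V W : gradedModType K) (k : int)
    (f : V -> W) :=
  forall n x, homog n x -> homog (n + k) (f x).

Section HomogeneousSums.
Variables (K : fieldType) (V : gradedModType K) (M : lmodType K).
Variable F : int -> V -> M.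
Hypothesis FL : forall i, linear (F i).

Let F0 i : F i 0 = 0.
Proof.
by have := FL i (-1) 0 0; rewrite !scaleN1r oppr0 addr0 addNr.
Qed.

Lemma hsumE (s : seq int) x : uniq s ->
    (forall i, hproj i x != 0 -> i \in s) ->
  \sum_(i \in [set: int]) F i (hproj i x) = \sum_(i <- s) F i (hproj i x).
Proof.
move=> us xs; rewrite (fsbigE s) //; first by apply: eq_bigl => i; rewrite in_setT.
move=> i _ /negP is_; have [->//|/xs//] := eqVneq (hproj i x) 0; exact: F0.
Qed.

Lemma hsupp_exists (x : V) :
  exists2 s : seq int, uniq s & forall i, hproj i x != 0 -> i \in s.
Proof.
have fx := hproj_finite x.
exists (fset_set [set i | hproj i x != 0]); first exact: fset_uniq.
by move=> i xi; rewrite in_fset_set // inE.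
Qed.

Lemma hsum_linear : linear (fun x => \sum_(i \in [set: int]) F i (hproj i x)).
Proof.
move=> a x y; have [[s _ xs] [t _ yt]] := (hsupp_exists x, hsupp_exists y).
have uu : uniq (undup (s ++ t)) by exact: undup_uniq.
rewrite !(hsumE uu).
- rewrite scaler_sumr -big_split; apply: eq_bigr => i _ /=.
  by rewrite linearP FL.
- by move=> i /yt it; rewrite mem_undup mem_cat it orbT.
- by move=> i /xs si; rewrite mem_undup mem_cat si.
move=> i; rewrite linearP /= mem_undup mem_cat => xy0; apply/orP.
have [x0|/xs ->] := eqVneq (hproj i x) 0; last by left.
by right; apply: yt; move: xy0; rewrite x0 scaler0 add0r.
Qed.

Lemma hsum_homog n x : homog n x ->
  \sum_(i \in [set: int]) F i (hproj i x) = F n x.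
Proof.
move=> hx; rewrite (@hsumE [:: n]) //; first by rewrite big_seq1 hx.
by move=> i; apply: contraNT; rewrite inE => /negPf ni; rewrite -hx hproj_hproj ni.
Qed.

End HomogeneousSums.

Lemma homog_hproj (K : fieldType) (V : gradedModType K) n m (x : V) :
  homog n x -> hproj m x = if m == n then x else 0.
Proof. by move=> <-; rewrite hproj_hproj. Qed.

Lemma homogP (K : fieldType) (V : gradedModType K) n (x : V) :
  homog n (hproj n x).
Proof. by rewrite /homog hproj_hproj eqxx. Qed.

Section GradingOfGenerators.
Variables (K : fieldType) (M : lmodType K) (P : int -> M -> M).
Hypothesis PL : forall i, linear (P i).

Definition decomposable (x : M) := exists2 s : seq M, x = \sum_(y <- s) y &
  forall y, y \in s -> exists n, forall m, P m y = if m == n then y else 0.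

Lemma decomposable0 : decomposable 0.
Proof. by exists [::]; rewrite ?big_nil. Qed.

Lemma decomposableP a x y :
  decomposable x -> decomposable y -> decomposable (a *: x + y).
Proof.
move=> [s -> hs] [t -> ht]; exists (map (GRing.scale a) s ++ t).
  by rewrite big_cat big_map scaler_sumr.
move=> z; rewrite mem_cat => /orP[/mapP[w /hs [n hn] ->]|/ht//].
exists n => m; have := PL m a w 0; rewrite !addr0 => ->.
have -> : P m 0 = 0.
  by have := PL m (-1) 0 0; rewrite !scaleN1r oppr0 addr0 addNr.
by rewrite hn addr0; case: eqP => //; rewrite scaler0.
Qed.

Lemma decomposableD x y :
  decomposable x -> decomposable y -> decomposable (x + y).
Proof. by move=> dx; rewrite -[x]scale1r; apply: decomposableP. Qed.

Lemma decomposable_homog n y :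
  (forall m, P m y = if m == n then y else 0) -> decomposable y.
Proof.
move=> hy; exists [:: y]; first by rewrite big_seq1.
by move=> z; rewrite inE => /eqP ->; exists n.
Qed.

Hypothesis dec : forall x, decomposable x.

Let P' i : {linear M -> M} := HB.pack (P i) (GRing.isLinear.Build K _ _ _ (P i) (PL i)).

Let P0 i : P i 0 = 0. Proof. exact: (raddf0 (P' i)). Qed.

Lemma gen_hproj_hproj i j x : P i (P j x) = if i == j then P j x else 0.
Proof.
have [s -> hs] := dec x; rewrite -[P i]/(P' i : _ -> _) -[P j]/(P' j : _ -> _).
rewrite !raddf_sum /=.
have -> : (if i == j then \sum_(y <- s) P j y else 0) =
          \sum_(y <- s) (if i == j then P j y else 0).
  by case: eqP => // _; rewrite big1.
apply: eq_big_seq => y /hs [n hn]; rewrite !hn; case: eqP => [->|_].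
  by rewrite hn; case: eqP.
by rewrite P0 if_same.
Qed.

Let hdeg (s : seq M) :
    (forall y, y \in s -> exists n, forall m, P m y = if m == n then y else 0) ->
  exists2 ns : seq int, uniq ns & forall y, y \in s ->
    exists2 n, n \in ns & forall m, P m y = if m == n then y else 0.
Proof.
elim: s => [|y s IHs] hs; first by exists [::].
have [|ns uns hns] := IHs; first by move=> z zs; apply: hs; rewrite inE zs orbT.
have [n hn] := hs y (mem_head _ _).
exists (undup (n :: ns)); first exact: undup_uniq.
move=> z; rewrite inE => /predU1P[->|/hns [m mns hm]].
  by exists n; rewrite ?mem_undup ?mem_head.
by exists m; rewrite // mem_undup inE mns orbT.
Qed.

Let P_out (s : seq M) (ns : seq int) i :
    (forall y, y \in s ->
       exists2 n, n \in ns & forall m, P m y = if m == n then y else 0) ->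
  i \notin ns -> P i (\sum_(y <- s) y) = 0.
Proof.
move=> hns ins; rewrite -[P i]/(P' i : _ -> _) raddf_sum big1_seq //= => y.
move=> /hns [n nns hn]; rewrite hn; case: eqP => // ein.
by rewrite ein nns in ins.
Qed.

Lemma gen_hproj_finite x : finite_set [set i | P i x != 0].
Proof.
have [s -> /hdeg [ns uns hns]] := dec x.
apply: (@sub_finite_set _ _ [set` ns]); last exact: finite_seq.
move=> i /= Pi0; apply: contraNT Pi0 => ins.
by apply/eqP; apply: P_out hns ins.
Qed.

Lemma gen_hproj_sum x : \sum_(i \in [set: int]) P i x = x.
Proof.
have [s -> /hdeg [ns uns hns]] := dec x.
rewrite (fsbigE ns) //; last by move=> i _; apply: P_out.
rewrite (eq_bigl xpredT) => [|i]; last by rewrite in_setT.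
rewrite (eq_bigr (fun i => \sum_(y <- s) P i y)); last first.
  by move=> i _; rewrite -[P i]/(P' i : _ -> _) raddf_sum.
rewrite exchange_big; apply: eq_big_seq => y /hns [n nns hn].
rewrite (bigD1_seq n) //= hn eqxx big1 ?addr0 // => i /negPf.
by rewrite hn => ->.
Qed.

End GradingOfGenerators.

Section TensorGrading.
Variables (K : fieldType) (A B : gradedModType K).

(* (A \ox B)_n is the sum of the A_i \ox B_(n-i). *)
Definition tensor_hproj (n : int) : {linear tensor A B -> tensor A B} :=
  lift2 (fun a b => \sum_(i \in [set: int]) hproj i a \ox hproj (n - i) b).

Lemma tensor_hprojE n a b :
  tensor_hproj n (a \ox b) =
  \sum_(i \in [set: int]) hproj i a \ox hproj (n - i) b.
Proof.
rewrite lift2E //; split=> [{}b|{}a].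
  apply: (@hsum_linear _ _ _ (fun i u => u \ox hproj (n - i) b)) => i.
  exact: tens_linearl.
move=> k x y; have [s us as_] := hsupp_exists a.
have lF z i : linear (fun u : A => u \ox hproj (n - i) z : tensor A B).
  exact: tens_linearl.
rewrite !(hsumE (lF _) us as_) scaler_sumr -big_split; apply: eq_bigr => i _ /=.
by rewrite linearP tens_linearr.
Qed.

Lemma tensor_hproj_homog n i j a b : homog i a -> homog j b ->
  tensor_hproj n (a \ox b) = if n == i + j then a \ox b else 0.
Proof.
move=> ha hb; rewrite tensor_hprojE (hsum_homog (F := fun i u => u \ox hproj (n - i) b) _ ha);
  last by move=> k; apply: tens_linearl.
rewrite (homog_hproj _ hb) subr_eq [j + i]addrC; case: eqP => // _.
by have := tens_linearr a (-1) (0 : B) 0; rewrite !scaleN1r oppr0 addr0 addNr.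
Qed.

Lemma tensor_decomposable x : decomposable tensor_hproj x.
Proof.
elim/tensor_ind: x => [|k x y|a b]; first exact: decomposable0.
  by apply: decomposableP => i; apply: linearP.
have L i : linear (tensor_hproj i) by move=> ? ? ?; apply: linearP.
pose l (z : B) : {linear A -> tensor A B} := HB.pack (fun u : A => u \ox z)
  (GRing.isLinear.Build K _ _ _ (fun u : A => u \ox z) (@tens_linearl K A B z)).
pose r (z : A) : {linear B -> tensor A B} := HB.pack (fun u : B => z \ox u)
  (GRing.isLinear.Build K _ _ _ (fun u : B => z \ox u) (@tens_linearr K A B z)).
have [s us as_] := hsupp_exists a; have [t ut bt] := hsupp_exists b.
have ea : a = \sum_(i <- s) hproj i a.
  by rewrite -[LHS]hproj_sum (hsumE (F := fun=> id) _ us as_).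
have eb : b = \sum_(i <- t) hproj i b.
  by rewrite -[LHS]hproj_sum (hsumE (F := fun=> id) _ ut bt).
rewrite ea -[tens _ _]/(l b _) raddf_sum.
elim/big_ind: _ => [|x y|i _]; [exact: decomposable0|exact: decomposableD|].
rewrite /= eb -[tens _ _]/(r _ _) raddf_sum.
elim/big_ind: _ => [|x y|j _]; [exact: decomposable0|exact: decomposableD|].
apply: (@decomposable_homog _ _ _ (i + j)) => m /=.
by apply: tensor_hproj_homog; apply: homogP.
Qed.

Fact tensor_hproj_linear i : linear (tensor_hproj i).
Proof. by move=> ? ? ?; apply: linearP. Qed.

HB.instance Definition _ := isGraded.Build K (tensor A B)
  tensor_hproj_linear
  (gen_hproj_hproj tensor_hproj_linear tensor_decomposable)
  (gen_hproj_finite tensor_hproj_linear tensor_decomposable)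
  (gen_hproj_sum tensor_hproj_linear tensor_decomposable).

End TensorGrading.

Lemma linear_comb (K : fieldType) (A B : lmodType K) (f g : {linear A -> B}) k :
  linear (fun x => k *: f x + g x).
Proof.
by move=> a x y; rewrite (linearP f) (linearP g) !scalerDr !scalerA addrACA mulrC.
Qed.

Lemma linear_comp (K : fieldType) (A B C : lmodType K)
  (g : {linear B -> C}) (f : {linear A -> B}) : linear (fun x => g (f x)).
Proof. by move=> a x y; rewrite (linearP f) (linearP g). Qed.

Section KoszulSigns.
Variable K : fieldType.

Definition koszul (A : gradedModType K) (k : int) (a : A) : A :=
  \sum_(i \in [set: int]) (-1 : K) ^ (k * i) *: hproj i a.

Let koszulF (A : gradedModType K) k i : linear (fun a : A => (-1 : K) ^ (k * i) *: a).
Proof. by move=> c x y; rewrite scalerDr !scalerA mulrC. Qed.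

Lemma koszul_linear (A : gradedModType K) k : linear (@koszul A k).
Proof. exact: (hsum_linear (koszulF k)). Qed.

Lemma koszul_homog (A : gradedModType K) k n (a : A) : homog n a ->
  koszul k a = (-1 : K) ^ (k * n) *: a.
Proof. exact: (hsum_homog (koszulF k)). Qed.

(* The map f \ox g for g of degree k, with the Koszul sign rule:
   a \ox b |-> (-1)^(k * |a|) f a \ox g b. *)
Definition tmap (A B C D : gradedModType K) (k : int) (f : A -> C) (g : B -> D) :
    {linear tensor A B -> tensor C D} :=
  lift2 (fun a b => f (koszul k a) \ox g b).

Lemma tmapE (A B C D : gradedModType K) k (f : A -> C) (g : B -> D) a b :
  linear f -> linear g -> tmap k f g (a \ox b) = f (koszul k a) \ox g b.
Proof.
move=> lf lg; rewrite lift2E //; split=> [{}b|{}a] c x y.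
  by rewrite koszul_linear lf tens_linearl.
by rewrite lg tens_linearr.
Qed.

Lemma tmap_homog (A B C D : gradedModType K) k (f : A -> C) (g : B -> D) n a b :
    linear f -> linear g -> homog n a ->
  tmap k f g (a \ox b) = (-1 : K) ^ (k * n) *: (f a \ox g b).
Proof.
move=> lf lg ha; rewrite tmapE // (koszul_homog _ ha).
pose h : {linear A -> tensor C D} := HB.pack (fun u : A => f u \ox g b)
  (GRing.isLinear.Build K _ _ _ (fun u : A => f u \ox g b)
    (fun c x y => etrans (congr1 (fun z => z \ox g b) (lf c x y))
                         (tens_linearl (g b) c (f x) (f y)))).
exact: (linearZZ h).
Qed.

Variables A B C D : gradedModType K.

(* (a \ox b) \ox (c \ox d) |-> (-1)^(|b| * |c|) (a \ox c) \ox (b \ox d) *)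
Definition swap23 : {linear tensor (tensor A B) (tensor C D) ->
                            tensor (tensor A C) (tensor B D)} :=
  lift2 (fun x y => lift2 (fun a b => lift2 (fun c d =>
    \sum_(i \in [set: int]) \sum_(j \in [set: int])
      (-1 : K) ^ (i * j) *: ((a \ox hproj j c) \ox (hproj i b \ox d))) y) x).

Let F a b c d : tensor (tensor A C) (tensor B D) :=
  \sum_(i \in [set: int]) \sum_(j \in [set: int])
      (-1 : K) ^ (i * j) *: ((a \ox hproj j c) \ox (hproj i b \ox d)).

Let G i a b c d : tensor (tensor A C) (tensor B D) :=
  \sum_(j \in [set: int]) (-1 : K) ^ (i * j) *: ((a \ox hproj j c) \ox (b \ox d)).

Let H i j a b c d : tensor (tensor A C) (tensor B D) :=
  (-1 : K) ^ (i * j) *: ((a \ox c) \ox (b \ox d)).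

Let Ha i j b c d : linear (fun a => H i j a b c d).
Proof.
by move=> k x y; rewrite /H tens_linearl tens_linearl scalerDr !scalerA mulrC.
Qed.
Let Hb i j a c d : linear (fun b => H i j a b c d).
Proof.
by move=> k x y; rewrite /H tens_linearl tens_linearr scalerDr !scalerA mulrC.
Qed.
Let Hc i j a b d : linear (fun c => H i j a b c d).
Proof.
by move=> k x y; rewrite /H tens_linearr tens_linearl scalerDr !scalerA mulrC.
Qed.
Let Hd i j a b c : linear (fun d => H i j a b c d).
Proof.
by move=> k x y; rewrite /H !tens_linearr scalerDr !scalerA mulrC.
Qed.

Let GE i a b c d s : uniq s -> (forall j, hproj j c != 0 -> j \in s) ->
  G i a b c d = \sum_(j <- s) H i j a b (hproj j c) d.
Proof. exact: (hsumE (fun j => Hc i j a b d)). Qed.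

Let Ga i b c d : linear (fun a => G i a b c d).
Proof.
move=> k x y; have [s us cs] := hsupp_exists c.
rewrite !(GE _ _ _ _ us cs) scaler_sumr -big_split.
by apply: eq_bigr => j _; rewrite Ha.
Qed.
Let Gb i a c d : linear (fun b => G i a b c d).
Proof.
move=> k x y; have [s us cs] := hsupp_exists c.
rewrite !(GE _ _ _ _ us cs) scaler_sumr -big_split.
by apply: eq_bigr => j _; rewrite Hb.
Qed.
Let Gc i a b d : linear (fun c => G i a b c d).
Proof. exact: (hsum_linear (fun j => Hc i j a b d)). Qed.
Let Gd i a b c : linear (fun d => G i a b c d).
Proof.
move=> k x y; have [s us cs] := hsupp_exists c.
rewrite !(GE _ _ _ _ us cs) scaler_sumr -big_split.
by apply: eq_bigr => j _; rewrite Hd.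
Qed.

Let FE a b c d s : uniq s -> (forall i, hproj i b != 0 -> i \in s) ->
  F a b c d = \sum_(i <- s) G i a (hproj i b) c d.
Proof. exact: (hsumE (fun i => Gb i a c d)). Qed.

Let Fa b c d : linear (fun a => F a b c d).
Proof.
move=> k x y; have [s us bs] := hsupp_exists b.
rewrite !(FE _ _ _ us bs) scaler_sumr -big_split.
by apply: eq_bigr => i _; rewrite Ga.
Qed.
Let Fb a c d : linear (fun b => F a b c d).
Proof. exact: (hsum_linear (fun i => Gb i a c d)). Qed.
Let Fc a b d : linear (fun c => F a b c d).
Proof.
move=> k x y; have [s us bs] := hsupp_exists b.
rewrite !(FE _ _ _ us bs) scaler_sumr -big_split.
by apply: eq_bigr => i _; rewrite Gc.
Qed.
Let Fd a b c : linear (fun d => F a b c d).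
Proof.
move=> k x y; have [s us bs] := hsupp_exists b.
rewrite !(FE _ _ _ us bs) scaler_sumr -big_split.
by apply: eq_bigr => i _; rewrite Gd.
Qed.

Lemma swap23E a b c d :
  swap23 ((a \ox b) \ox (c \ox d)) =
  \sum_(i \in [set: int]) \sum_(j \in [set: int])
    (-1 : K) ^ (i * j) *: ((a \ox hproj j c) \ox (hproj i b \ox d)).
Proof.
pose L a b : {linear tensor C D -> tensor (tensor A C) (tensor B D)} :=
  lift2 (F a b).
have LE a' b' c' d' : L a' b' (c' \ox d') = F a' b' c' d'.
  by rewrite lift2E.
have La y : bilinear2 (fun a b => L a b y).
  split=> [b'|a'] k x x'.
    apply: (tensor_ext (f := fun y => L (k *: x + x') b' y)
      (g := fun y => k *: L x b' y + L x' b' y)) y => [||c' d'].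
    - by move=> ? ? ?; apply: linearP.
    - exact: linear_comb.
    - by rewrite !LE Fa.
  apply: (tensor_ext (f := fun y => L a' (k *: x + x') y)
    (g := fun y => k *: L a' x y + L a' x' y)) y => [||c' d'].
  - by move=> ? ? ?; apply: linearP.
  - exact: linear_comb.
  - by rewrite !LE Fb.
rewrite /swap23 lift2E; first by rewrite (lift2E (La _)) LE.
split=> [y|x] k u v; first by rewrite linearP.
apply: (tensor_ext (f := lift2 (fun a b => L a b (k *: u + v)))
    (g := fun x => k *: lift2 (fun a b => L a b u) x
                   + lift2 (fun a b => L a b v) x)) x => [||a' b'].
- by move=> ? ? ?; apply: linearP.
- exact: linear_comb.
- by rewrite !lift2E // linearP.
Qed.

Lemma swap23_homog i j a b c d : homog i b -> homog j c ->
  swap23 ((a \ox b) \ox (c \ox d)) =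
  (-1 : K) ^ (i * j) *: ((a \ox c) \ox (b \ox d)).
Proof.
move=> hb hc; rewrite swap23E.
rewrite (hsum_homog (F := fun i b => G i a b c d) _ hb);
  last by move=> ?; apply: Gb.
exact: (hsum_homog (fun j => Hc i j a b d) hc).
Qed.

End KoszulSigns.

Section TensorCoalgebra.
Variables (K : fieldType) (V : lmodType K).

Inductive word_rel : set {malg K[seq V]} :=
| word_rel_intro (w1 w2 : seq V) (k : K) (x y : V) :
    word_rel (<< w1 ++ (k *: x + y) :: w2 >>
      - (k *: << w1 ++ x :: w2 >> + << w1 ++ y :: w2 >>)).

(* The relations are homogeneous in the length of words, so this is the direct
   sum over n of the modules generated by words of length n subject to
   multilinearity, i.e. of the n-th tensor powers of V. *)
Definition Tc : Type := presmod word_rel.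
HB.instance Definition _ := GRing.Lmodule.on Tc.

Definition word (w : seq V) : Tc := gen word_rel w.

Definition Tc1 : Tc := word [::].

Definition multilinear (M : lmodType K) (f : seq V -> M) :=
  forall w1 w2 k x y, f (w1 ++ (k *: x + y) :: w2) =
    k *: f (w1 ++ x :: w2) + f (w1 ++ y :: w2).

Lemma word_multilinear : multilinear word.
Proof. by move=> w1 w2 k x y; apply: gen_rel. Qed.

(* The linear map v_1 ... v_n |-> f [:: v_1; ...; v_n], for multilinear f. *)
Definition wlift (M : lmodType K) (f : seq V -> M) : {linear Tc -> M} :=
  lift word_rel f.

Lemma wliftE (M : lmodType K) (f : seq V -> M) : multilinear f ->
  forall w, wlift f (word w) = f w.
Proof.
move=> fl w; rewrite /wlift /word liftE // => r [] *.
by rewrite linearB linearP /= !fextU fl subrr.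
Qed.

Lemma Tc_ind (P : Tc -> Prop) :
    P 0 -> (forall a x y, P x -> P y -> P (a *: x + y)) ->
  (forall w, P (word w)) -> forall x, P x.
Proof. exact: presmod_ind. Qed.

Lemma Tc_ext (M : lmodType K) (f g : Tc -> M) : linear f -> linear g ->
  (forall w, f (word w) = g (word w)) -> f =1 g.
Proof. exact: presmod_ext. Qed.

Definition Delta : {linear Tc -> tensor Tc Tc} :=
  wlift (fun w =>
    \sum_(i < (size w).+1) word (take i w) \ox word (drop i w)).

Lemma Delta_word w :
  Delta (word w) = \sum_(i < (size w).+1) word (take i w) \ox word (drop i w).
Proof.
apply: (@wliftE _ (fun w => \sum_(i < (size w).+1) word (take i w) \ox word (drop i w))).
move=> w1 w2 k x y; rewrite !size_cat /= scaler_sumr -big_split.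
apply: eq_bigr => i _ /=; rewrite !take_cat !drop_cat.
case: ltnP => [lti|lei]; first by rewrite word_multilinear tens_linearr.
case: (i - size w1)%N => [|n] /=.
  by rewrite (word_multilinear [::]) tens_linearr.
by rewrite word_multilinear tens_linearl.
Qed.

Definition eps : {linear Tc -> K^o} := wlift (fun w => (nilp w)%:R : K^o).

Lemma eps_word w : eps (word w) = (nilp w)%:R.
Proof.
apply: (@wliftE _ (fun w => (nilp w)%:R : K^o)) => w1 w2 k x y.
by rewrite /nilp !size_cat !addnS scaler0 addr0.
Qed.

Definition tcons (v : V) : {linear Tc -> Tc} := wlift (fun w => word (v :: w)).

Lemma tcons_word v w : tcons v (word w) = word (v :: w).
Proof.
apply: (@wliftE _ (fun w => word (v :: w))) => w1 w2 k x y.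
exact: (word_multilinear (v :: w1)).
Qed.

Lemma tcons_linear x : linear (tcons^~ x).
Proof.
move=> k u v; apply: (Tc_ext (f := tcons (k *: u + v))
  (g := fun x => k *: tcons u x + tcons v x)) x => [||w].
- by move=> ? ? ?; apply: linearP.
- exact: linear_comb.
- by rewrite !tcons_word (word_multilinear [::]).
Qed.

(* v_1 ... v_n |-> (m (... (m v_1 v_2) ...) v_n) for n >= 1. This map is only
   meant on the kernel of eps; it is extended by 0 to the empty word. *)
Definition tau1 (m : V -> V -> V) : {linear Tc -> V} :=
  wlift (fun w => if w is v :: w' then foldl m v w' else 0).

Lemma tau1_word m : bilinear2 m -> forall w,
  tau1 m (word w) = if w is v :: w' then foldl m v w' else 0.
Proof.
move=> [ml mr] w.
apply: (@wliftE _ (fun w => if w is v :: w' then foldl m v w' else 0)).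
have fl w2 k x y : foldl m (k *: x + y) w2 = k *: foldl m x w2 + foldl m y w2.
  by elim: w2 x y => //= v w2 IH x y; rewrite ml IH.
move=> [|v w1] w2 k x y //=.
by rewrite !foldl_cat /= mr fl.
Qed.

End TensorCoalgebra.

Arguments Delta {K V}.
Arguments eps {K V}.

Section TensorCoalgebraGrading.
Variables (K : fieldType) (V : gradedModType K).

(* Component of degree n of a word: the degree of a word in homogeneous
   letters is the sum of the degrees of the letters. *)
Fixpoint word_hproj (n : int) (w : seq V) : Tc V :=
  if w is v :: w' then
    \sum_(i \in [set: int]) tcons (hproj i v) (word_hproj (n - i) w')
  else if n == 0 then Tc1 V else 0.

Definition Tc_hproj (n : int) : {linear Tc V -> Tc V} := wlift (word_hproj n).

Lemma Tc_hproj_word n w : Tc_hproj n (word w) = word_hproj n w.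
Proof.
apply: wliftE => {w} w1; elim: w1 n => [|v w1 IH] n w2 k x y /=.
  apply: (@hsum_linear _ _ _ (fun i u => tcons u (word_hproj (n - i) w2))) => i.
  exact: tcons_linear.
have [s us vs] := hsupp_exists v.
have lF z i : linear (fun u => tcons u (word_hproj (n - i) z)).
  exact: tcons_linear.
rewrite !(hsumE (lF _) us vs) scaler_sumr -big_split; apply: eq_bigr => i _ /=.
by rewrite IH linearP.
Qed.

Lemma Tc_hproj_tcons n i v x : homog i v ->
  Tc_hproj n (tcons v x) = tcons v (Tc_hproj (n - i) x).
Proof.
move=> hv; apply: (Tc_ext (f := fun x => Tc_hproj n (tcons v x))
  (g := fun x => tcons v (Tc_hproj (n - i) x))) x => [||w].
- exact: linear_comp.
- exact: linear_comp.
rewrite tcons_word !Tc_hproj_word /=.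
rewrite (hsum_homog (F := fun i u => tcons u (word_hproj (n - i) w)) _ hv) //.
by move=> j; apply: tcons_linear.
Qed.

Lemma Tc_hproj_homog (w : seq (int * V)) n :
    (forall p, p \in w -> homog p.1 p.2) ->
  Tc_hproj n (word (map snd w)) =
  if n == \sum_(p <- w) p.1 then word (map snd w) else 0.
Proof.
elim: w n => [|[i v] w IH] n hw; first by rewrite Tc_hproj_word big_nil.
rewrite /= big_cons /= -tcons_word (@Tc_hproj_tcons n i v); last first.
  exact: (hw (i, v) (mem_head _ _)).
rewrite IH => [|p pw]; last by apply: hw; rewrite inE pw orbT.
by rewrite subr_eq [_ + i]addrC; case: eqP => // _; rewrite linear0.
Qed.

Fact Tc_hproj_linear i : linear (Tc_hproj i).
Proof. by move=> ? ? ?; apply: linearP. Qed.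

Lemma Tc_decomposable x : decomposable Tc_hproj x.
Proof.
elim/Tc_ind: x => [|k x y|w]; first exact: decomposable0.
  by apply: decomposableP; apply: Tc_hproj_linear.
elim: w => [|v w [s ew hs]].
  by apply: (@decomposable_homog _ _ _ 0) => m; rewrite Tc_hproj_word.
have dD := decomposableD Tc_hproj_linear.
have [t ut vt] := hsupp_exists v.
have ev : v = \sum_(i <- t) hproj i v.
  by rewrite -[LHS]hproj_sum (hsumE (F := fun=> id) _ ut vt).
rewrite -tcons_word ew linear_sum big_seq.
elim/big_ind: _ => [|//|y /hs [n hn]]; first exact: decomposable0.
pose l : {linear V -> Tc V} := HB.pack (fun u => tcons u y)
  (GRing.isLinear.Build K _ _ _ (fun u => tcons u y) (tcons_linear y)).
rewrite ev -[tcons _ _]/(l _) raddf_sum.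
elim/big_ind: _ => [|//|i _]; first exact: decomposable0.
apply: (@decomposable_homog _ _ _ (n + i)) => m /=.
rewrite (Tc_hproj_tcons _ _ (homogP i v)) hn subr_eq.
by case: eqP => // _; rewrite linear0.
Qed.

HB.instance Definition _ := isGraded.Build K (Tc V)
  Tc_hproj_linear
  (gen_hproj_hproj Tc_hproj_linear Tc_decomposable)
  (gen_hproj_finite Tc_hproj_linear Tc_decomposable)
  (gen_hproj_sum Tc_hproj_linear Tc_decomposable).

End TensorCoalgebraGrading.

Section BInfinity.
Variables (K : fieldType) (V : gradedModType K).
Local Notation T := (Tc V).
Local Notation TT := (tensor (Tc V) (Tc V)).

(* (23) (Delta \ox Delta) *)
Definition DeltaTT : TT -> tensor TT TT :=
  fun x => swap23 T T T T (tmap 0 Delta Delta x).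

Definition epsTT : TT -> K := lift2 (fun x y => eps x * eps y : K^o).

Lemma epsTTE (x y : T) : epsTT (x \ox y) = eps x * eps y.
Proof.
rewrite /epsTT lift2E //; split=> [{}y|{}x] k u v; rewrite linearP /=.
  by rewrite mulrDl -mulrA.
by rewrite mulrDr mulrCA.
Qed.

(* The operators d \ox id + id \ox d are sums of tmap 0 d id and
   tmap (-1) id d, where -1 is the degree of d. *)
Record Binfty (mu : TT -> T) (d : T -> T) : Prop := {
  mu_linear : linear mu;
  mu_degree : has_degree 0 mu;
  mu_comult : forall x, Delta (mu x) = tmap 0 mu mu (DeltaTT x);
  mu_counit : forall x, eps (mu x) = epsTT x;
  mu_assoc : forall x y z, mu (mu (x \ox y) \ox z) = mu (x \ox mu (y \ox z));
  mu_unitl : forall x, mu (Tc1 V \ox x) = x;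
  mu_unitr : forall x, mu (x \ox Tc1 V) = x;
  d_linear : linear d;
  d_degree : has_degree (-1) d;
  d_coder : forall x,
    Delta (d x) = tmap 0 d id (Delta x) + tmap (-1) id d (Delta x);
  d_unit : d (Tc1 V) = 0;
  d_square : forall x, d (d x) = 0;
  d_mu : forall x, d (mu x) = mu (tmap 0 d id x + tmap (-1) id d x)
}.

Record two_assoc_dga (dot odot : V -> V -> V) (one : V) (del : V -> V)
    : Prop := {
  dot_bilinear : bilinear2 dot;
  dot_degree : forall i j x y,
    homog i x -> homog j y -> homog (i + j) (dot x y);
  dot_assoc : associative dot;
  dot_unitl : left_id one dot;
  dot_unitr : right_id one dot;
  one_degree : homog 0 one;
  del_linear : linear del;
  del_degree : has_degree (-1) del;
  del_square : forall x, del (del x) = 0;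
  del_derivation : forall i x y, homog i x ->
    del (dot x y) = dot (del x) y + (-1 : K) ^ i *: dot x (del y);
  odot_bilinear : bilinear2 odot;
  odot_degree : forall i j x y,
    homog i x -> homog j y -> homog (i + j) (odot x y);
  odot_assoc : associative odot;
  odot_unitl : left_id one odot;
  odot_unitr : right_id one odot
}.

End BInfinity.

(* Main.v *)
From HB Require Import structures.
Require Import Defs.
From mathcomp Require Import all_boot ssralg ssrint.
From mathcomp Require Import ring.
From mathcomp Require Import boolp.

Set Implicit Arguments.
Unset Strict Implicit.
Unset Printing Implicit Defensive.

Import GRing.Theory.
Local Open Scope ring_scope.

(** A linear map from a conilpotent coalgebra to Tc V that respects the
    coproducts is determined by its component in V, and every degree 0 map to
    V killing the unit lifts to such a coalgebra map [cofree]. The component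
    in V can be read off with tau1 instead of the projection pr1, because tau1
    is the identity on words of length one: if two coalgebra maps have the same
    composite with tau1 and agree on all smaller elements, the coproduct of
    their difference at x has no part in which both factors are nontrivial, so
    the difference is a word of length one, and tau1 sees it. The same argument
    applies to coderivations, and [vanishing] covers all cases at once.

    This gives uniqueness of mu and of d, and reduces each law of a B-infinity
    structure to an identity in V: associativity, the unit laws, d d = 0 and
    the Leibniz rule all say that two coalgebra maps, or two coderivations
    along a coalgebra map, coincide. With the unital extension
    utau x = eps x one + tau1 x, the two requirements become
    utau (mu (x \ox y)) = dot (utau x) (utau y) and utau (d x) = del (utau x),
    so that after applying utau the laws of Tc V turn into the axioms of the
    differential graded algebra (V, dot, one, del).

    Associativity of odot enters the existence part. The coalgebra
    endomorphism sigma of Tc V with component v_1 ... v_n |->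
    (-1)^(n-1) v_1 odot ... odot v_n satisfies tau1 sigma = pr1
    [straightening_exists]; this is the identity saying that x / (1 + x) is
    inverse to x / (1 - x). Let tau be the coalgebra map with component tau1,
    so that sigma tau = id. Then mu is sigma composed with the coalgebra map
    whose component is dot (utau x) (utau y) off the unit, and d is sigma d' tau
    where d' is the derivation of the concatenation product extending del.

    All computations take place on words in homogeneous letters, and on pairs
    and triples of such words, where a coproduct is a finite sum over ways of
    cutting. A [splitting] records this combinatorics, and the product of two
    splittings carries the Koszul sign, so that coassociativity of the
    coproduct of Tc V \ox Tc V is a single sign comparison [prod_coassoc]. *)

(** * Linearity and Koszul signs *)

Section LinearMaps.
Variables (K : fieldType) (A B : lmodType K) (f : A -> B).
Hypothesis fL : linear f.

Let f' : {linear A -> B} := HB.pack f (GRing.isLinear.Build K _ _ _ f fL).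

Lemma lin0 : f 0 = 0. Proof. exact: (linear0 f'). Qed.
Lemma linD x y : f (x + y) = f x + f y. Proof. exact: (linearD f'). Qed.
Lemma linB x y : f (x - y) = f x - f y. Proof. exact: (linearB f'). Qed.
Lemma linZ k x : f (k *: x) = k *: f x. Proof. exact: (linearZZ f'). Qed.
Lemma lin_sum I (r : seq I) (P : pred I) F :
  f (\sum_(i <- r | P i) F i) = \sum_(i <- r | P i) f (F i).
Proof. exact: (linear_sum f'). Qed.

End LinearMaps.

Section Tens.
Variables (K : fieldType) (A B : lmodType K).
Implicit Types (a : A) (b : B).

Lemma tensDl a a' b : (a + a') \ox b = a \ox b + a' \ox b.
Proof. exact: (linD (tens_linearl b)). Qed.
Lemma tensDr a b b' : a \ox (b + b') = a \ox b + a \ox b'.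
Proof. exact: (linD (tens_linearr a)). Qed.
Lemma tensBl a a' b : (a - a') \ox b = a \ox b - a' \ox b.
Proof. exact: (linB (tens_linearl b)). Qed.
Lemma tensBr a b b' : a \ox (b - b') = a \ox b - a \ox b'.
Proof. exact: (linB (tens_linearr a)). Qed.
Lemma tensZl k a b : (k *: a) \ox b = k *: (a \ox b).
Proof. exact: (linZ (tens_linearl b)). Qed.
Lemma tensZr k a b : a \ox (k *: b) = k *: (a \ox b).
Proof. exact: (linZ (tens_linearr a)). Qed.
Lemma tens0l b : (0 : A) \ox b = 0.
Proof. exact: (lin0 (tens_linearl b)). Qed.
Lemma tens0r a : a \ox (0 : B) = 0.
Proof. exact: (lin0 (tens_linearr a)). Qed.
End Tens.

Section Signs.
Variable K : fieldType.

Definition ksign (i : int) : K := (-1) ^ i.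

Lemma ksignD i j : ksign (i + j) = ksign i * ksign j.
Proof. by rewrite /ksign expfzDr // oppr_eq0 oner_eq0. Qed.

Lemma ksign0 : ksign 0 = 1. Proof. by []. Qed.

Lemma ksignN1 : ksign (-1) = -1.
Proof. by rewrite /ksign exprN1 invrN1. Qed.

Lemma ksign_sqr i : ksign i * ksign i = 1.
Proof. by rewrite /ksign -expfzMl mulrNN mulr1 exp1rz. Qed.

(** For linear arithmetic on the exponents of signs, with an explicit half of
    the difference. *)
Lemma ksign_parity k i j : i = j + (k + k) -> ksign i = ksign j.
Proof. by move->; rewrite ksignD ksignD ksign_sqr mulr1. Qed.

End Signs.

Section Graded.
Variable K : fieldType.

Lemma homogD (V : gradedModType K) n (x y : V) :
  homog n x -> homog n y -> homog n (x + y).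
Proof. by rewrite /homog (linD (@hproj_linear _ _ n)) => -> ->. Qed.

Lemma homogZ (V : gradedModType K) n k (x : V) :
  homog n x -> homog n (k *: x).
Proof. by rewrite /homog (linZ (@hproj_linear _ _ n)) => ->. Qed.

Lemma homog0 (V : gradedModType K) n : homog n (0 : V).
Proof. exact: (lin0 (@hproj_linear _ _ n)). Qed.

Lemma homogN (V : gradedModType K) n (x : V) : homog n x -> homog n (- x).
Proof. by rewrite -scaleN1r; apply: homogZ. Qed.

Lemma koszul0 (V : gradedModType K) (x : V) : koszul 0 x = x.
Proof.
rewrite -[RHS]hproj_sum /koszul; apply: fsbigop.eq_fsbigr => i _.
by rewrite mul0r expr0z scale1r.
Qed.

Lemma tens_homog (A B : gradedModType K) i j (a : A) (b : B) :
  homog i a -> homog j b -> homog (i + j) (a \ox b).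
Proof.
move=> ha hb; rewrite /homog.
by rewrite [LHS](tensor_hproj_homog _ ha hb) eqxx.
Qed.

Lemma tmap0E (A B C D : gradedModType K) (f : A -> C) (g : B -> D) a b :
  linear f -> linear g -> tmap 0 f g (a \ox b) = f a \ox g b.
Proof. by move=> fL gL; rewrite tmapE // koszul0. Qed.

Lemma homog_ind (V : gradedModType K) (P : V -> Prop) :
    P 0 -> (forall x y, P x -> P y -> P (x + y)) ->
  (forall n x, homog n x -> P x) -> forall x, P x.
Proof.
move=> P0 PD Ph x; have [s us xs] := hsupp_exists x.
rewrite -[x]hproj_sum (hsumE (F := fun=> id) _ us xs) //.
by elim/big_ind: _ => // i _; apply: Ph (homogP i x).
Qed.

End Graded.

(** * Splittings *)

Section DecompositionSum.
Variables (K : fieldType) (I : eqType) (s : seq (K * I * I)).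

(** Sweedler summation: an entry (c, a, b) of s stands for the term
    c a \ox b of a coproduct, on which a bilinear expression F is evaluated. *)
Definition dsum (M : lmodType K) (F : I -> I -> M) : M :=
  \sum_(t <- s) t.1.1 *: F t.1.2 t.2.

Lemma dsumD (M : lmodType K) (F G : I -> I -> M) :
  dsum (fun a b => F a b + G a b) = dsum F + dsum G.
Proof. by rewrite /dsum -big_split; apply: eq_bigr => t _; rewrite scalerDr. Qed.

Lemma dsumZ (M : lmodType K) k (F : I -> I -> M) :
  dsum (fun a b => k *: F a b) = k *: dsum F.
Proof.
by rewrite /dsum scaler_sumr; apply: eq_bigr => t _; rewrite !scalerA mulrC.
Qed.

Lemma dsumB (M : lmodType K) (F G : I -> I -> M) :
  dsum (fun a b => F a b - G a b) = dsum F - dsum G.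
Proof.
rewrite dsumD -scaleN1r -dsumZ; congr (_ + _).
by apply: eq_bigr => t _; rewrite scaleN1r.
Qed.

Lemma dsum_lin (M N : lmodType K) (f : M -> N) (F : I -> I -> M) :
  linear f -> f (dsum F) = dsum (fun a b => f (F a b)).
Proof.
by move=> fL; rewrite /dsum (lin_sum fL); apply: eq_bigr => t _; rewrite (linZ fL).
Qed.

Lemma eq_dsum (M : lmodType K) (F G : I -> I -> M) :
  (forall a b, F a b = G a b) -> dsum F = dsum G.
Proof. by move=> FG; apply: eq_bigr => t _; rewrite FG. Qed.

End DecompositionSum.

Lemma exchange_dsum (K : fieldType) (I J : eqType) (s : seq (K * I * I))
    (r : seq (K * J * J)) (M : lmodType K) (F : I -> I -> J -> J -> M) :
  dsum s (fun a b => dsum r (F a b)) =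
  dsum r (fun c d => dsum s (fun a b => F a b c d)).
Proof.
rewrite /dsum; under eq_bigr do rewrite scaler_sumr.
rewrite exchange_big; apply: eq_bigr => t _; rewrite scaler_sumr.
by apply: eq_bigr => u _; rewrite !scalerA mulrC.
Qed.

(** A conilpotent graded coalgebra with a distinguished set of generators. The
    laws quantify over arbitrary functions of the indices rather than over
    multilinear maps, so they apply to families of vectors that are not known to
    come from a linear map, in particular to triples of words without any
    coalgebra structure on a threefold tensor product. An index of weight 0
    stands for the unit, hence the two counit laws. *)
Record splitting (K : fieldType) := Splitting {
  idx :> eqType;
  wt : idx -> nat;
  dg : idx -> int;
  splits : idx -> seq (K * idx * idx);
  splits_wt : forall i t, t \in splits i -> (wt t.1.2 + wt t.2)%N = wt i;
  splits_dg : forall i t, t \in splits i -> dg t.1.2 + dg t.2 = dg i;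
  dg_wt0 : forall i, wt i = 0%N -> dg i = 0;
  dsum_counitl : forall (M : lmodType K) (G : idx -> M) i,
    dsum (splits i) (fun a b => if wt a == 0%N then G b else 0) = G i;
  dsum_counitr : forall (M : lmodType K) (G : idx -> M) i,
    dsum (splits i) (fun a b => if wt b == 0%N then G a else 0) = G i;
  dsum_coassoc : forall (M : lmodType K) (G : idx -> idx -> idx -> M) i,
    dsum (splits i) (fun a b => dsum (splits a) (fun a1 a2 => G a1 a2 b)) =
    dsum (splits i) (fun a b => dsum (splits b) (fun b1 b2 => G a b1 b2))
}.

Section SplittingTheory.
Variables (K : fieldType) (S : splitting K).

Lemma eq_splits (M : lmodType K) (i : S) (F G : S -> S -> M) :
    (forall a b, (wt a + wt b)%N = wt i -> dg a + dg b = dg i ->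
       F a b = G a b) ->
  dsum (splits i) F = dsum (splits i) G.
Proof.
move=> FG; apply: eq_big_seq => t ti; rewrite FG //.
  exact: splits_wt ti.
exact: splits_dg ti.
Qed.

Lemma splits0 (M : lmodType K) (i : S) (F : S -> S -> M) :
    (forall a b, (wt a + wt b)%N = wt i -> F a b = 0) ->
  dsum (splits i) F = 0.
Proof.
move=> F0; rewrite (@eq_splits _ _ _ (fun _ _ => 0)) => [|a b /F0 //].
by apply: big1 => t _; rewrite scaler0.
Qed.

Lemma wt_ltr (a b i : S) :
  (wt a + wt b)%N = wt i -> wt a != 0%N -> (wt b < wt i)%N.
Proof. by move=> <- na; rewrite -[X in (X < _)%N]add0n ltn_add2r lt0n. Qed.

Lemma wt_ltl (a b i : S) :
  (wt a + wt b)%N = wt i -> wt b != 0%N -> (wt a < wt i)%N.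
Proof. by rewrite addnC; apply: wt_ltr. Qed.

End SplittingTheory.

Section Product.
Variables (K : fieldType) (S T : splitting K).
Implicit Types (p : (S * T)%type).

Definition prod_wt p := (wt p.1 + wt p.2)%N.
Definition prod_dg p := dg p.1 + dg p.2.

(** The middle interchange moves t.2 past u.1.2, which produces the sign. *)
Definition prod_splits p : seq (K * (S * T) * (S * T)) :=
  [seq (t.1.1 * u.1.1 * ksign K (dg t.2 * dg u.1.2),
        (t.1.2, u.1.2), (t.2, u.2)) | t <- splits p.1, u <- splits p.2].

Lemma dsum_prod (M : lmodType K) p (F : S * T -> S * T -> M) :
  dsum (prod_splits p) F =
  dsum (splits p.1) (fun a b => dsum (splits p.2) (fun c d =>
    ksign K (dg b * dg c) *: F (a, c) (b, d))).
Proof.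
rewrite /dsum /prod_splits big_allpairs_dep /=; apply: eq_bigr => t _.
rewrite scaler_sumr; apply: eq_bigr => u _ /=.
by rewrite !scalerA.
Qed.

Let mem_prod_splits p t : t \in prod_splits p ->
  exists u v, [/\ u \in splits p.1, v \in splits p.2,
    t.1.2 = (u.1.2, v.1.2) & t.2 = (u.2, v.2)].
Proof. by case/allpairsP => -[u v] /= [us vs ->]; exists u, v. Qed.

Fact prod_splits_wt p t :
  t \in prod_splits p -> (prod_wt t.1.2 + prod_wt t.2)%N = prod_wt p.
Proof.
case/mem_prod_splits => u [v [/splits_wt us /splits_wt vs -> ->]].
by rewrite /prod_wt /= addnACA us vs.
Qed.

Fact prod_splits_dg p t :
  t \in prod_splits p -> prod_dg t.1.2 + prod_dg t.2 = prod_dg p.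
Proof.
case/mem_prod_splits => u [v [/splits_dg us /splits_dg vs -> ->]].
by rewrite /prod_dg /= addrACA us vs.
Qed.

Fact prod_dg_wt0 p : prod_wt p = 0%N -> prod_dg p = 0.
Proof.
move/eqP; rewrite addn_eq0 => /andP[/eqP p1 /eqP p2].
by rewrite /prod_dg !dg_wt0.
Qed.

Fact prod_counitl (M : lmodType K) (G : S * T -> M) p :
  dsum (prod_splits p) (fun a b => if prod_wt a == 0%N then G b else 0) = G p.
Proof.
rewrite dsum_prod; case: p => i j /=.
rewrite -[RHS](dsum_counitl (fun b => G (b, j))); apply: eq_dsum => a b.
have [a0|na] := eqVneq (wt a) 0%N; last first.
  apply: splits0 => c d _.
  by rewrite /prod_wt addn_eq0 (negPf na) scaler0.
rewrite -[RHS](dsum_counitl (fun d => G (b, d))); apply: eq_dsum => c d.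
rewrite /prod_wt addn_eq0 a0 /=.
by case: eqP => [/dg_wt0 ->|_]; rewrite ?mulr0 ?ksign0 ?scale1r ?scaler0.
Qed.

Fact prod_counitr (M : lmodType K) (G : S * T -> M) p :
  dsum (prod_splits p) (fun a b => if prod_wt b == 0%N then G a else 0) = G p.
Proof.
rewrite dsum_prod; case: p => i j /=.
rewrite -[RHS](dsum_counitr (fun a => G (a, j))); apply: eq_dsum => a b.
have [b0|nb] := eqVneq (wt b) 0%N; last first.
  apply: splits0 => c d _.
  by rewrite /prod_wt addn_eq0 (negPf nb) scaler0.
rewrite -[RHS](dsum_counitr (fun c => G (a, c))); apply: eq_dsum => c d.
rewrite /prod_wt addn_eq0 b0 (dg_wt0 b0) /=.
by case: eqP => _; rewrite ?mul0r ?ksign0 ?scale1r ?scaler0.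
Qed.

(** Both sides run over the ways of cutting i into x, y, z and j into x', y', z'.
    The interleaved order x x' y y' z z' puts x' behind y and z, and y' behind z;
    the sign of that permutation, written in H, does not depend on the order
    in which the two cuts are made. *)
Fact prod_coassoc (M : lmodType K) (G : S * T -> S * T -> S * T -> M) p :
  dsum (prod_splits p) (fun a b =>
    dsum (prod_splits a) (fun a1 a2 => G a1 a2 b)) =
  dsum (prod_splits p) (fun a b =>
    dsum (prod_splits b) (fun b1 b2 => G a b1 b2)).
Proof.
case: p => i j; rewrite !dsum_prod /=.
pose H (x y z : S) (x' y' z' : T) :=
  ksign K (dg y * dg x' + dg z * dg x' + dg z * dg y') *:
    G (x, x') (y, y') (z, z').
transitivity (dsum (splits i) (fun a b => dsum (splits a) (fun a1 a2 =>
   dsum (splits j) (fun c d => dsum (splits c) (fun c1 c2 =>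
     H a1 a2 b c1 c2 d))))).
  apply: eq_dsum => a b; rewrite exchange_dsum; apply: eq_splits => c d _ _.
  rewrite dsum_prod -dsumZ; apply: eq_dsum => a1 a2; rewrite -dsumZ.
  apply: eq_splits => c1 c2 _ <-.
  rewrite /H scalerA -ksignD; congr (ksign K _ *: _).
  by rewrite mulrDr addrC addrA.
under eq_dsum => a b do under eq_dsum => a1 a2 do rewrite dsum_coassoc.
rewrite dsum_coassoc.
apply: eq_dsum => a b; rewrite exchange_dsum; apply: eq_splits => c d _ _.
rewrite dsum_prod -dsumZ; apply: eq_splits => b1 b2 _ <-.
rewrite -dsumZ; apply: eq_dsum => d1 d2.
rewrite /H scalerA -ksignD; congr (ksign K _ *: _).
by rewrite mulrDl.
Qed.

Definition prod_splitting : splitting K :=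
  Splitting prod_splits_wt prod_splits_dg prod_dg_wt0
    prod_counitl prod_counitr prod_coassoc.

End Product.

(** * Words in homogeneous letters *)

Section Letters.
Variables (K : fieldType) (V : gradedModType K).

Definition letter := {p : int * V | `[< homog p.1 p.2 >]}.
Definition ldeg (l : letter) : int := (val l).1.
Definition lval (l : letter) : V := (val l).2.

Lemma lvalP l : homog (ldeg l) (lval l).
Proof. exact: asboolW (valP l). Qed.

Definition Letter n (v : V) (hv : homog n v) : letter :=
  exist _ (n, v) (asboolT hv).

Implicit Types (v : V) (w : seq letter).

Lemma tcons0l (x : Tc V) : tcons 0 x = 0.
Proof. exact: (lin0 (tcons_linear x)). Qed.

Definition hword w : Tc V := word (map lval w).
Definition wdeg w : int := \sum_(l <- w) ldeg l.

Lemma hword_cons l w : hword (l :: w) = tcons (lval l) (hword w).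
Proof. by rewrite /hword tcons_word. Qed.

Lemma tcons_homog i j v (x : Tc V) :
  homog i v -> homog j x -> homog (i + j) (tcons v x).
Proof.
move=> hv hx; rewrite /homog; rewrite [LHS](Tc_hproj_tcons _ _ hv).
by rewrite addrAC subrr add0r; congr (tcons v _).
Qed.

Lemma Tc1_homog : homog 0 (Tc1 V).
Proof. by rewrite /homog; rewrite [LHS](Tc_hproj_word 0 [::]). Qed.

Lemma hword_homog w : homog (wdeg w) (hword w).
Proof.
elim: w => [|l w IH]; first by rewrite /wdeg big_nil; apply: Tc1_homog.
by rewrite /wdeg big_cons hword_cons; apply: tcons_homog => //; apply: lvalP.
Qed.

(** Letters can be split into homogeneous components one at a time, because
    the property may be tested on tcons v x instead of x. *)
Lemma hword_ind (P : Tc V -> Prop) :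
    P 0 -> (forall a x y, P x -> P y -> P (a *: x + y)) ->
  (forall w, P (hword w)) -> forall x, P x.
Proof.
move=> P0 PD Ph; apply: Tc_ind => // w.
elim: w P P0 PD Ph => [|v w IH] P P0 PD Ph; first exact: (Ph [::]).
rewrite -tcons_word; apply: (IH (fun x => P (tcons v x))).
- by rewrite linear0.
- by move=> a x y Px Py; rewrite linearP; apply: PD.
move=> u; elim/homog_ind: v => [|x y Px Py|n x hx].
- by rewrite tcons0l.
- by rewrite (linD (tcons_linear _)) -[tcons x _]scale1r; apply: PD.
by have := Ph (Letter hx :: u); rewrite hword_cons.
Qed.

(** Deconcatenation, by recursion on the first letter: it is either cut off
    together with everything else or belongs to the left factor. *)
Fixpoint wsplits w : seq (K * seq letter * seq letter) :=
  if w is l :: w' then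
    (1, [::], w) :: [seq (t.1.1, l :: t.1.2, t.2) | t <- wsplits w']
  else [:: (1, [::], [::])].

Lemma dsum_nil (M : lmodType K) (F : seq letter -> seq letter -> M) :
  dsum (wsplits [::]) F = F [::] [::].
Proof. by rewrite /dsum big_seq1 scale1r. Qed.

Lemma dsum_cons (M : lmodType K) l w (F : seq letter -> seq letter -> M) :
  dsum (wsplits (l :: w)) F =
  F [::] (l :: w) + dsum (wsplits w) (fun a b => F (l :: a) b).
Proof. by rewrite /dsum big_cons big_map scale1r. Qed.

Fact wsplits_wt w t : t \in wsplits w -> (size t.1.2 + size t.2)%N = size w.
Proof.
elim: w t => [|l w IH] t /=; first by rewrite inE => /eqP ->.
by rewrite inE => /predU1P[->//|/mapP[u /IH uw ->]] /=; rewrite addSn uw.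
Qed.

Fact wsplits_dg w t : t \in wsplits w -> wdeg t.1.2 + wdeg t.2 = wdeg w.
Proof.
elim: w t => [|l w IH] t /=; first by rewrite inE => /eqP ->; rewrite /wdeg big_nil.
rewrite inE => /predU1P[->|/mapP[u /IH uw ->]] /=.
  by rewrite /wdeg big_nil add0r.
by rewrite {1 3}/wdeg !big_cons -addrA -/(wdeg _) uw.
Qed.

Fact wdeg_size0 w : size w = 0%N -> wdeg w = 0.
Proof. by case: w => // _; apply: big_nil. Qed.

Fact wsplits_counitl (M : lmodType K) (G : seq letter -> M) w :
  dsum (wsplits w) (fun a b => if size a == 0%N then G b else 0) = G w.
Proof.
case: w => [|l w]; first by rewrite dsum_nil.
by rewrite dsum_cons /= [X in _ + X]big1 ?addr0 // => t _; rewrite scaler0.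
Qed.

Fact wsplits_counitr (M : lmodType K) (G : seq letter -> M) w :
  dsum (wsplits w) (fun a b => if size b == 0%N then G a else 0) = G w.
Proof.
elim: w G => [|l w IH] G; first by rewrite dsum_nil.
by rewrite dsum_cons /= add0r (IH (fun a => G (l :: a))).
Qed.

Fact wsplits_coassoc (M : lmodType K)
    (G : seq letter -> seq letter -> seq letter -> M) w :
  dsum (wsplits w) (fun a b => dsum (wsplits a) (fun a1 a2 => G a1 a2 b)) =
  dsum (wsplits w) (fun a b => dsum (wsplits b) (fun b1 b2 => G a b1 b2)).
Proof.
elim: w G => [|l w IH] G; first by rewrite !dsum_nil.
rewrite !dsum_cons dsum_nil -addrA; congr (_ + _).
rewrite -(IH (fun a => G (l :: a))) -dsumD.
by apply: eq_dsum => a b; rewrite dsum_cons.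
Qed.

Definition words : splitting K :=
  Splitting wsplits_wt wsplits_dg wdeg_size0
    wsplits_counitl wsplits_counitr wsplits_coassoc.

Definition consl v : {linear tensor (Tc V) (Tc V) -> tensor (Tc V) (Tc V)} :=
  lift2 (fun a b => tcons v a \ox b).

Lemma conslE v a b : consl v (a \ox b) = tcons v a \ox b.
Proof.
rewrite /consl lift2E //; split=> [{}b|{}a] k x y.
  by rewrite linearP tens_linearl.
exact: tens_linearr.
Qed.

Lemma consl0 x : consl 0 x = 0.
Proof.
apply: (tensor_ext (f := consl 0) (g := fun=> 0)) x => [||a b].
- exact: linearP.
- by move=> k x y; rewrite scaler0 addr0.
by rewrite conslE tcons0l tens0l.
Qed.

(** Only the cut in front of v separates v from the left factor; this
    recursion replaces the indexed sum defining the coproduct. *)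
Lemma Delta_tcons v x :
  Delta (tcons v x) = Tc1 V \ox tcons v x + consl v (Delta x).
Proof.
apply: (Tc_ext (f := fun x => Delta (tcons v x))
  (g := fun x => Tc1 V \ox tcons v x + consl v (Delta x))) x => [||w].
- exact: linear_comp.
- by move=> k x y; rewrite !linearP tens_linearr scalerDr addrACA.
rewrite tcons_word !Delta_word /= big_ord_recl /=; congr (_ + _).
by rewrite linear_sum; apply: eq_bigr => i _; rewrite conslE tcons_word.
Qed.

Lemma Delta_Tc1 : Delta (Tc1 V) = Tc1 V \ox Tc1 V.
Proof. by rewrite Delta_word big_ord_recl big_ord0 addr0. Qed.

Lemma Delta_hword w :
  Delta (hword w) = dsum (wsplits w) (fun a b => hword a \ox hword b).
Proof.
elim: w => [|l w IH]; first by rewrite dsum_nil Delta_Tc1.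
rewrite hword_cons Delta_tcons IH dsum_cons -hword_cons; congr (_ + _).
rewrite (dsum_lin _ _ (linearP (consl (lval l)))).
by apply: eq_dsum => a b; rewrite conslE hword_cons.
Qed.

Lemma eps_linear k (x y : Tc V) :
  eps (k *: x + y) = k * (eps x : K) + (eps y : K) :> K.
Proof. exact: linearP. Qed.

Lemma eps_hword w : eps (hword w) = (size w == 0%N)%:R.
Proof. by rewrite eps_word /nilp size_map. Qed.

Lemma eps_tcons v x : eps (tcons v x) = 0.
Proof.
apply: (Tc_ext (f := fun x => @eps K V (tcons v x)) (g := fun=> 0)) x => [||w].
- exact: linear_comp.
- by move=> k x y; rewrite scaler0 addr0.
by rewrite tcons_word eps_word.
Qed.

Lemma eps_Tc1 : @eps K V (Tc1 V) = 1. Proof. exact: eps_word. Qed.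

(** Associativity turns the left-nested products of tau1 into right-nested
    ones. The first summand accounts for the value 0 of tau1 on the empty
    word, where the unit of m would be expected. *)
Lemma tau1_tcons m v x : bilinear2 m -> associative m ->
  tau1 m (tcons v x) = (eps x : K) *: v + m v (tau1 m x).
Proof.
move=> mB mA; have [_ mr] := mB.
apply: (Tc_ext (f := fun x => tau1 m (tcons v x))
  (g := fun x => (eps x : K) *: v + m v (tau1 m x))) x => [||w].
- exact: linear_comp.
- move=> k x y; rewrite eps_linear linearP mr.
  by rewrite scalerDl scalerDr scalerA addrACA.
rewrite tcons_word !tau1_word // eps_word.
case: w => [|a w] /=; first by rewrite scale1r (lin0 (mr v)) addr0.
rewrite scale0r add0r; elim: w v a => //= b w IH v a.
by rewrite -mA IH.
Qed.

Lemma tau1_Tc1 m : bilinear2 m -> tau1 m (Tc1 V) = 0.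
Proof. by move=> mB; rewrite tau1_word. Qed.

(** Projection onto words of length one. *)
(** The projection onto words of length one: with the zero product, all longer
    words are sent to 0. *)
Definition pr1 : {linear Tc V -> V} := tau1 (fun _ _ => 0).

Let zero_bilinear : @bilinear2 K V V V (fun _ _ : V => 0 : V).
Proof. by split=> ? ? ? ?; rewrite scaler0 addr0. Qed.

Lemma pr1_tcons v x : pr1 (tcons v x) = (eps x : K) *: v.
Proof. by rewrite /pr1 tau1_tcons // addr0. Qed.

Lemma pr1_Tc1 : pr1 (Tc1 V) = 0.
Proof. exact: tau1_Tc1. Qed.

Definition aug (x : Tc V) : Tc V := x - (eps x : K) *: Tc1 V.

Lemma aug_linear : linear aug.
Proof.
by move=> k x y; rewrite /aug eps_linear scalerDl scalerBr scalerA opprD addrACA.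
Qed.

Lemma eps_aug x : eps (aug x) = 0.
Proof.
have -> : aug x = - (eps x : K) *: Tc1 V + x by rewrite addrC scaleNr.
by rewrite eps_linear eps_Tc1 mulr1 addNr.
Qed.

Lemma aug_Tc1 : aug (Tc1 V) = 0.
Proof. by rewrite /aug eps_Tc1 scale1r subrr. Qed.

(** A left inverse of the reduced coproduct on words of length at least two:
    on v_1 ... v_n only the cut after v_1 survives. *)
Definition unshift : {linear tensor (Tc V) (Tc V) -> Tc V} :=
  lift2 (fun a b => tcons (pr1 a) (aug b)).

Lemma unshiftE a b : unshift (a \ox b) = tcons (pr1 a) (aug b).
Proof.
rewrite /unshift lift2E //; split=> [{}b|{}a] k x y.
  by rewrite linearP tcons_linear.
by rewrite aug_linear linearP.
Qed.

(** An element is determined by its counit, its letter component and its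
    reduced coproduct; this is the cogeneration of Tc V by V. *)
Lemma Tc_decomposition x :
  x = (eps x : K) *: Tc1 V + tcons (pr1 x) (Tc1 V) + unshift (Delta x).
Proof.
elim/hword_ind: x => [|k x y IHx IHy|w].
- by rewrite !linear0 tcons0l scale0r !addr0.
- rewrite {1}IHx {1}IHy eps_linear !linearP tcons_linear scalerDl !scalerDr scalerA.
  by rewrite addrACA; congr (_ + _); rewrite addrACA.
case: w => [|l w].
  rewrite [hword _]/(Tc1 V) Delta_Tc1 unshiftE pr1_Tc1 eps_Tc1.
  by rewrite !tcons0l scale1r !addr0.
rewrite Delta_hword dsum_cons hword_cons eps_tcons pr1_tcons scale0r add0r.
rewrite linearD unshiftE [hword [::]]/(Tc1 V) pr1_Tc1 tcons0l add0r.
rewrite (dsum_lin _ _ (linearP unshift)).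
have E : dsum (wsplits w) (fun a b => unshift (hword (l :: a) \ox hword b)) =
    tcons (lval l) (aug (hword w)).
  rewrite -[RHS](wsplits_counitl (fun b => tcons (lval l) (aug (hword b)))).
  apply: eq_dsum => a b; rewrite unshiftE hword_cons pr1_tcons eps_hword.
  by case: eqP => _; rewrite ?scale1r // scale0r tcons0l.
rewrite E /aug (linZ (tcons_linear _)) linearB [tcons _ (_ *: _)]linearZ /=.
by rewrite addrC subrK.
Qed.

End Letters.

Arguments pr1 {K V}.
Arguments aug {K V}.
Arguments unshift {K V}.

(** * Maps determined by their composite with tau1 *)

Section Vanishing.
Variables (K : fieldType) (V : gradedModType K) (S : splitting K).
Variables (m : V -> V -> V) (mB : bilinear2 m) (mA : associative m).

(** A difference f - g of coalgebra maps satisfies the first hypothesis with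
    h = f and k = g, and a coderivation along f does with h = f and k = f up to
    sign. By induction on the weight only the terms with a factor of weight 0
    are left, and [unshift] kills those. Hence delta i is a single letter, and
    tau1 is the identity on letters. *)
Lemma vanishing (delta h k : S -> Tc V) :
    (forall i, Delta (delta i) = dsum (splits i) (fun a b =>
       delta a \ox h b + k a \ox delta b)) ->
    (forall i, eps (delta i) = 0) -> (forall i, tau1 m (delta i) = 0) ->
    (forall i, wt i = 0%N -> delta i = 0) ->
    (forall i, wt i = 0%N -> aug (h i) = 0) ->
    (forall i, wt i = 0%N -> pr1 (k i) = 0) ->
  forall i, delta i = 0.
Proof.
move=> deltaD deltae deltat delta0 h0 k0 i.
have [n] := ubnP (wt i); elim: n => // n IH in i *; rewrite ltnS => in_.
have U : unshift (Delta (delta i)) = 0.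
  rewrite deltaD (dsum_lin _ _ (linearP _)); apply: splits0 => a b ab.
  rewrite linearD /= !unshiftE.
  have da : tcons (pr1 (delta a)) (aug (h b)) = 0.
    have [b0|nb] := eqVneq (wt b) 0%N; first by rewrite h0 // linear0.
    rewrite IH ?linear0 ?tcons0l //.
    exact: leq_trans (wt_ltl ab nb) in_.
  have db : tcons (pr1 (k a)) (aug (delta b)) = 0.
    have [a0|na] := eqVneq (wt a) 0%N; first by rewrite k0 // tcons0l.
    rewrite IH ?(lin0 (@aug_linear _ _)) ?linear0 //.
    exact: leq_trans (wt_ltr ab na) in_.
  by rewrite da db addr0.
have E := Tc_decomposition (delta i).
rewrite deltae U scale0r add0r addr0 in E.
have := deltat i; rewrite E tau1_tcons // eps_Tc1 scale1r tau1_Tc1 //.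
by have [_ mr] := mB; rewrite (lin0 (mr _)) addr0 => ->; rewrite tcons0l.
Qed.

End Vanishing.

(** * Coalgebras presented by a splitting system *)

(** The conilpotent coalgebra (C, D, e) is spanned by the vectors vec i, whose
    coproducts are given by the splitting S. The vectors need not be linearly
    independent, so linear maps on C are not defined by their values on them. *)
Record presented (K : fieldType) (S : splitting K) (C : gradedModType K)
    (D : C -> tensor C C) (e : C -> K) (vec : S -> C) : Prop := {
  D_linear : linear D;
  e_linear : forall k x y, e (k *: x + y) = k * e x + e y;
  vec_ind : forall P : C -> Prop, P 0 ->
    (forall a x y, P x -> P y -> P (a *: x + y)) ->
    (forall i, P (vec i)) -> forall x, P x;
  vec_homog : forall i, homog (dg i) (vec i);
  D_vec : forall i, D (vec i) = dsum (splits i) (fun a b => vec a \ox vec b);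
  e_vec : forall i, e (vec i) = (wt i == 0%N)%:R
}.

Section Presented.
Variables (K : fieldType) (S : splitting K) (C : gradedModType K).
Variables (D : C -> tensor C C) (e : C -> K) (vec : S -> C).
Hypothesis CP : presented D e vec.

Lemma vec_ext (M : lmodType K) (f g : C -> M) : linear f -> linear g ->
  (forall i, f (vec i) = g (vec i)) -> f =1 g.
Proof.
move=> fL gL fg; apply: (vec_ind CP) => // [|a x y fx fy].
  by rewrite (lin0 fL) (lin0 gL).
by rewrite fL gL fx fy.
Qed.

Lemma vec_degree (W : gradedModType K) k (f : C -> W) : linear f ->
  (forall i, homog (dg i + k) (f (vec i))) -> has_degree k f.
Proof.
move=> fL fh n x; rewrite /homog => hx.
rewrite -{2}hx; move: x {hx}.
apply: (vec_ext (f := fun x => hproj (n + k) (f x))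
  (g := fun x => f (hproj n x))) => [a x y|a x y|i].
- by rewrite fL (@hproj_linear _ _ (n + k)).
- by rewrite (@hproj_linear _ _ n) fL.
rewrite (homog_hproj _ (vec_homog CP i)) (homog_hproj _ (fh i)).
have -> : (n + k == dg i + k) = (n == dg i) by rewrite (inj_eq (addIr k)).
by case: eqP => // _; rewrite (lin0 fL).
Qed.

(** * Cofreeness *)

Section Lift.
Variables (V : gradedModType K) (phi : {linear C -> V}).
Hypothesis phi0 : forall i, wt i = 0%N -> phi (vec i) = 0.

(** The lift is the solution of Phi x = e x 1 + phi(x1) Phi(x2) in Sweedler
    notation. As phi kills the unit, the equation determines Phi on an index
    from its values on smaller weights, so the iterates of step become
    stationary at every vector. Iterating linear maps on C avoids having to
    check that values prescribed on generators are compatible. *)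
Let step (L : C -> Tc V) (x : C) : Tc V :=
  e x *: Tc1 V + lift2 (fun a b => tcons (phi a) (L b)) (D x).

Let approx n : C -> Tc V := iter n step (fun=> 0).

Let stepB (L : C -> Tc V) :
  linear L -> @bilinear2 K C C (Tc V) (fun a b => tcons (phi a) (L b)).
Proof.
move=> LL; split=> [b|a] k x y; first by rewrite linearP tcons_linear.
by rewrite LL linearP.
Qed.

Let approx_linear n : linear (approx n).
Proof.
elim: n => [|n IH] k x y /=; first by rewrite scaler0 addr0.
rewrite /step (e_linear CP) (D_linear CP) linearP scalerDl scalerDr scalerA.
exact: addrACA.
Qed.

Let approx_vec n i : approx n.+1 (vec i) =
  e (vec i) *: Tc1 V +
  dsum (splits i) (fun a b => tcons (phi (vec a)) (approx n (vec b))).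
Proof.
rewrite /= /step (D_vec CP) (dsum_lin _ _ (linearP _)); congr (_ + _).
by apply: eq_dsum => a b; rewrite lift2E //; apply: stepB.
Qed.

Let approx_stable n p i : (wt i < n)%N -> (wt i < p)%N ->
  approx n (vec i) = approx p (vec i).
Proof.
elim: n p i => // n IH [|p] i //; rewrite !ltnS => iln ilp.
rewrite !approx_vec; congr (_ + _); apply: eq_splits => a b ab _.
have [a0|na] := eqVneq (wt a) 0%N; first by rewrite phi0 // !tcons0l.
have bi := wt_ltr ab na.
by rewrite (IH p b) //; apply: leq_trans bi _.
Qed.

Lemma lift_exists : exists Phi : {linear C -> Tc V}, forall i,
  Phi (vec i) = e (vec i) *: Tc1 V +
    dsum (splits i) (fun a b => tcons (phi (vec a)) (Phi (vec b))).
Proof.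
have lim x : exists n, forall p, (n <= p)%N -> approx p x = approx n x.
  elim/(vec_ind CP): x => [|a x y [n nx] [p py]|i].
  - by exists 0%N => p _; rewrite !(lin0 (approx_linear _)).
  - exists (maxn n p) => q; rewrite geq_max => /andP[nq pq].
    rewrite !approx_linear (nx q nq) (py q pq).
    by rewrite (nx _ (leq_maxl n p)) (py _ (leq_maxr n p)).
  by exists (wt i).+1 => p ip; apply: approx_stable.
pose N x := projT1 (cid (lim x)).
have NE x p : (N x <= p)%N -> approx p x = approx (N x) x.
  exact: (projT2 (cid (lim x))).
pose F x := approx (N x) x.
have FL : linear F.
  move=> a x y; pose p := maxn (N (a *: x + y)) (maxn (N x) (N y)).
  rewrite /F -(NE _ p) ?leq_maxl // approx_linear !(NE _ p) //.
    by rewrite leq_max leq_maxr orbT.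
  by rewrite leq_max leq_maxl orbT.
pose Phi : {linear C -> Tc V} :=
  HB.pack F (GRing.isLinear.Build K _ _ _ F FL).
have FE x p : (N x <= p)%N -> Phi x = approx p x by move=> /NE ->.
have Fvec i : Phi (vec i) = approx (wt i).+1 (vec i).
  rewrite (FE _ (maxn (N (vec i)) (wt i).+1)) ?leq_maxl //.
  by apply: approx_stable; rewrite // leq_max ltnSn orbT.
exists Phi => i; rewrite Fvec approx_vec; congr (_ + _).
apply: eq_splits => a b ab _.
have [a0|na] := eqVneq (wt a) 0%N; first by rewrite phi0 // !tcons0l.
rewrite Fvec; congr (tcons _ _); apply: approx_stable => //.
exact: wt_ltr ab na.
Qed.

Section LiftTheory.
Variable Phi : {linear C -> Tc V}.
Hypothesis PhiE : forall i,
  Phi (vec i) = e (vec i) *: Tc1 V +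
    dsum (splits i) (fun a b => tcons (phi (vec a)) (Phi (vec b))).

Lemma lift_counit x : eps (Phi x) = e x.
Proof.
elim/(vec_ind CP): x => [|k x y Px Py|i].
- rewrite linear0 linear0.
  by have := e_linear CP (-1) 0 0; rewrite scaleN1r oppr0 addr0 mulN1r addNr.
- by rewrite linearP eps_linear Px Py (e_linear CP).
rewrite PhiE eps_linear eps_Tc1 mulr1 (dsum_lin _ _ (linearP eps)).
by rewrite splits0 ?addr0 // => a b _; rewrite eps_tcons.
Qed.

Lemma lift_pr1 x : pr1 (Phi x) = phi x.
Proof.
move: x; apply: vec_ext => [||i]; try exact: linear_comp.
  exact: linearP.
rewrite PhiE linearP pr1_Tc1 scaler0 add0r (dsum_lin _ _ (linearP _)).
rewrite -[RHS](dsum_counitr (fun a => phi (vec a))); apply: eq_dsum => a b.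
by rewrite pr1_tcons lift_counit (e_vec CP); case: eqP; rewrite ?scale1r ?scale0r.
Qed.

(** Substituting the equation for Phi in either side gives the same expression
    after one use of coassociativity, up to terms where the statement is known
    for a smaller index. *)
Lemma lift_Delta i :
  Delta (Phi (vec i)) =
  dsum (splits i) (fun a b => Phi (vec a) \ox Phi (vec b)).
Proof.
have [n] := ubnP (wt i); elim: n => // n IH in i *; rewrite ltnS => in_.
have E : Delta (Phi (vec i)) = Tc1 V \ox Phi (vec i) +
    dsum (splits i) (fun a b => dsum (splits b) (fun b1 b2 =>
       tcons (phi (vec a)) (Phi (vec b1)) \ox Phi (vec b2))).
  rewrite PhiE linearP Delta_Tc1 (dsum_lin _ _ (linearP _)) tensDr tensZr -addrA.
  congr (_ + _); rewrite (dsum_lin _ _ (tens_linearr _)) -dsumD.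
  apply: eq_splits => a b ab _; rewrite Delta_tcons; congr (_ + _).
  have [a0|na] := eqVneq (wt a) 0%N.
    rewrite phi0 // consl0 splits0 // => b1 b2 _.
    by rewrite tcons0l tens0l.
  rewrite IH; last exact: leq_trans (wt_ltr ab na) in_.
  rewrite (dsum_lin _ _ (linearP _)); apply: eq_dsum => b1 b2.
  by rewrite conslE.
rewrite E -(dsum_coassoc (fun a1 a2 b =>
  tcons (phi (vec a1)) (Phi (vec a2)) \ox Phi (vec b))).
rewrite -[X in X + _](dsum_counitl (fun b => Tc1 V \ox Phi (vec b))) -dsumD.
apply: eq_dsum => a b; rewrite [in RHS]PhiE tensDl tensZl.
rewrite (dsum_lin _ _ (tens_linearl _)); congr (_ + _).
by rewrite (e_vec CP); case: eqP; rewrite ?scale1r ?scale0r.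
Qed.

Lemma lift_degree : has_degree 0 phi -> has_degree 0 Phi.
Proof.
move=> phid; apply: vec_degree => [|i]; first exact: linearP.
have [n] := ubnP (wt i); elim: n => // n IH in i *; rewrite ltnS => in_.
rewrite PhiE addr0; apply: homogD.
  rewrite (e_vec CP); case: eqP => [/dg_wt0 ->|_]; last first.
    by rewrite scale0r; apply: homog0.
  by rewrite scale1r; apply: Tc1_homog.
(* A sum of vectors fixed by a projection is in the image of the projection. *)
rewrite (@eq_splits _ _ _ _ _ (fun a b =>
    hproj (dg i) (tcons (phi (vec a)) (Phi (vec b))))).
  by rewrite -(dsum_lin _ _ (@hproj_linear _ _ _)); apply: homogP.
move=> a b ab <-.
have [a0|na] := eqVneq (wt a) 0%N.
  by rewrite phi0 // tcons0l linear0.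
symmetry; apply: tcons_homog.
  by have := phid _ _ (vec_homog CP a); rewrite addr0.
rewrite -[dg b]addr0; apply: IH.
exact: leq_trans (wt_ltr ab na) in_.
Qed.

End LiftTheory.
End Lift.
End Presented.

Record coalgebra_map (K : fieldType) (V C : gradedModType K)
    (D : C -> tensor C C) (e : C -> K) (Phi : C -> Tc V) : Prop := {
  cm_linear : linear Phi;
  cm_degree : has_degree 0 Phi;
  cm_comult : forall x, Delta (Phi x) = tmap 0 Phi Phi (D x);
  cm_counit : forall x, eps (Phi x) = e x
}.

Section CoalgebraMaps.
Variables (K : fieldType) (V : gradedModType K) (S : splitting K).
Variables (C : gradedModType K) (D : C -> tensor C C) (e : C -> K).
Variable vec : S -> C.
Hypothesis CP : presented D e vec.

Theorem cofree (phi : {linear C -> V}) : has_degree 0 phi ->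
    (forall i, wt i = 0%N -> phi (vec i) = 0) ->
  exists Phi : C -> Tc V, [/\ coalgebra_map D e Phi,
    forall i, wt i = 0%N -> Phi (vec i) = Tc1 V
    & forall x, pr1 (Phi x) = phi x].
Proof.
move=> phid phi0; have [Phi PhiE] := lift_exists CP phi0.
exists Phi; split=> [|i i0|]; last exact: (lift_pr1 CP PhiE); last first.
  rewrite PhiE (e_vec CP) i0 scale1r splits0 ?addr0 // => a b /eqP.
  rewrite i0 addn_eq0 => /andP[/eqP a0 _].
  by rewrite phi0 // tcons0l.
split=> [|||x]; [exact: linearP|exact: (lift_degree CP phi0 PhiE)| |].
  apply: (vec_ext CP) => [k x y|k x y|i]; first by rewrite !linearP.
    by rewrite (D_linear CP) linearP.
  rewrite (lift_Delta CP phi0 PhiE) (D_vec CP) (dsum_lin _ _ (linearP _)).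
  by apply: eq_dsum => a b; rewrite tmap0E //; apply: linearP.
exact: (lift_counit CP PhiE).
Qed.

Lemma cm_vec (Phi : C -> Tc V) i : coalgebra_map D e Phi ->
  Delta (Phi (vec i)) =
  dsum (splits i) (fun a b => Phi (vec a) \ox Phi (vec b)).
Proof.
move=> cm; rewrite (cm_comult cm) (D_vec CP) (dsum_lin _ _ (linearP _)).
by apply: eq_dsum => a b; rewrite tmap0E //; apply: cm_linear cm.
Qed.

Variables (m : V -> V -> V) (mB : bilinear2 m) (mA : associative m).

(** tau1 separates coalgebra maps as well as pr1 does, because their difference
    satisfies the hypotheses of [vanishing]. *)
Theorem cofree_unique (Phi Psi : C -> Tc V) :
    coalgebra_map D e Phi -> coalgebra_map D e Psi ->
    (forall i, wt i = 0%N -> Phi (vec i) = Tc1 V) ->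
    (forall i, wt i = 0%N -> Psi (vec i) = Tc1 V) ->
    (forall i, tau1 m (Phi (vec i)) = tau1 m (Psi (vec i))) ->
  Phi =1 Psi.
Proof.
move=> cP cQ P0 Q0 PQ.
apply: (vec_ext CP (cm_linear cP) (cm_linear cQ)) => i; apply/eqP.
rewrite -subr_eq0; apply/eqP; move: i.
apply: (@vanishing _ _ _ _ mB mA _ (fun i => Phi (vec i))
  (fun i => Psi (vec i))).
- move=> i; rewrite linearB (cm_vec _ cP) (cm_vec _ cQ) -dsumB.
  apply: eq_dsum => a b; rewrite tensBl tensBr.
  by rewrite addrA subrK.
- by move=> i; rewrite linearB (cm_counit cP) (cm_counit cQ) subrr.
- by move=> i; rewrite linearB /= PQ subrr.
- by move=> i i0; rewrite P0 // Q0 // subrr.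
- by move=> i i0; rewrite P0 // aug_Tc1.
- by move=> i i0; rewrite Q0 // pr1_Tc1.
Qed.

End CoalgebraMaps.

Lemma tmap0_comp (K : fieldType) (A B C A' B' C' : gradedModType K)
    (f : B -> C) (g : A -> B) (f' : B' -> C') (g' : A' -> B') x :
  linear f -> linear g -> linear f' -> linear g' ->
  tmap 0 f f' (tmap 0 g g' x) = tmap 0 (f \o g) (f' \o g') x.
Proof.
move=> fL gL fL' gL'; move: x; apply: tensor_ext => [||a b].
- exact: linear_comp.
- exact: linearP.
rewrite !tmap0E // => k x y /=; first by rewrite gL fL.
by rewrite gL' fL'.
Qed.

Lemma comp_coalgebra_map (K : fieldType) (V W C : gradedModType K)
    (D : C -> tensor C C) (e : C -> K) (Psi : Tc V -> Tc W) (Phi : C -> Tc V) :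
  @coalgebra_map K W (Tc V) Delta eps Psi -> coalgebra_map D e Phi ->
  coalgebra_map D e (Psi \o Phi).
Proof.
move=> cP cQ; split=> [k x y|n x hx|x|x] /=.
- by rewrite (cm_linear cQ) (cm_linear cP).
- by rewrite -[n + 0]addr0; apply: (cm_degree cP); apply: (cm_degree cQ).
- rewrite (cm_comult cP) (cm_comult cQ) tmap0_comp //; try exact: cm_linear cP.
  + exact: cm_linear cQ.
  + exact: cm_linear cQ.
- by rewrite (cm_counit cP) (cm_counit cQ).
Qed.

(** * The tensor coalgebra and its square *)

Section TensorCoalgebras.
Variables (K : fieldType) (V : gradedModType K).
Local Notation T := (Tc V).
Local Notation TT := (tensor (Tc V) (Tc V)).
Local Notation W := (words V).
Local Notation WW := (prod_splitting (words V) (words V)).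

Definition word_pair (p : WW) : TT := hword p.1 \ox hword p.2.

(** The tensor factors are families indexed by S and R, not only generators of
    Tc V: for iterated products they are products of words. *)
Lemma swap23_dsum (S R : splitting K) (i : S) (j : R)
    (A B : S -> T) (A' B' : R -> T) :
    (forall b, homog (dg b) (B b)) -> (forall c, homog (dg c) (A' c)) ->
  swap23 T T T T (dsum (splits i) (fun a b => A a \ox B b) \ox
                  dsum (splits j) (fun c d => A' c \ox B' d)) =
  dsum (splits i) (fun a b => dsum (splits j) (fun c d =>
    ksign K (dg b * dg c) *: ((A a \ox A' c) \ox (B b \ox B' d)))).
Proof.
move=> hB hA'; rewrite (dsum_lin _ _ (tens_linearl _)) (dsum_lin _ _ (linearP _)).
apply: eq_dsum => a b.
rewrite (dsum_lin _ _ (tens_linearr _)) (dsum_lin _ _ (linearP _)).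
by apply: eq_dsum => c d; rewrite (swap23_homog _ _ (hB b) (hA' c)).
Qed.

Lemma Tc_presented : @presented K W T Delta eps (@hword K V).
Proof.
split.
- exact: linearP.
- exact: eps_linear.
- exact: hword_ind.
- exact: hword_homog.
- exact: Delta_hword.
- exact: eps_hword.
Qed.

Lemma id_coalgebra_map : @coalgebra_map K V T Delta eps id.
Proof.
split=> [//|n y|y|//]; first by rewrite addr0.
move: (Delta y); apply: tensor_ext => [k u v|k u v|a b].
- by [].
- by rewrite linearP.
by rewrite tmap0E.
Qed.

Lemma DeltaTT_linear : linear (@DeltaTT K V).
Proof. by move=> k x y; rewrite /DeltaTT !linearP. Qed.

Lemma epsTT_linear : linear (@epsTT K V : TT -> K^o).
Proof. by move=> k x y; rewrite /epsTT linearP. Qed.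

Lemma DeltaTTE (x y : T) :
  DeltaTT (x \ox y) = swap23 T T T T (Delta x \ox Delta y).
Proof. by rewrite /DeltaTT tmap0E //; apply: linearP. Qed.

Lemma TT_presented : @presented K WW TT (@DeltaTT K V) (@epsTT K V) word_pair.
Proof.
split.
- exact: DeltaTT_linear.
- exact: epsTT_linear.
- move=> P P0 PD Ph; apply: tensor_ind => // x y.
  elim/hword_ind: x => [|k x x' Px Px'|u].
  + by rewrite tens0l.
  + by rewrite tens_linearl; apply: PD.
  elim/hword_ind: y => [|k y y' Py Py'|v].
  + by rewrite tens0r.
  + by rewrite tens_linearr; apply: PD.
  exact: (Ph (u, v)).
- by move=> p; apply: tens_homog; apply: hword_homog.
- case=> u v; rewrite /word_pair DeltaTTE !Delta_hword.
  rewrite (swap23_dsum (S := W) (R := W)) => [|b|c]; try exact: hword_homog.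
  by rewrite dsum_prod.
case=> u v; rewrite /word_pair epsTTE !eps_hword /= /prod_wt addn_eq0 /=.
by case: eqP => _; case: eqP => _; rewrite ?mulr0 ?mul0r ?mulr1.
Qed.

(** * Coalgebra maps from the square *)

Section Products.
Variable mu : TT -> T.
Hypothesis muC : coalgebra_map (@DeltaTT K V) (@epsTT K V) mu.

Let muL := cm_linear muC.

Lemma mu_homog i j (x y : T) :
  homog i x -> homog j y -> homog (i + j) (mu (x \ox y)).
Proof.
move=> hx hy; rewrite -[i + j]addr0; apply: (cm_degree muC).
exact: tens_homog.
Qed.

Lemma eps_mu x y : eps (mu (x \ox y)) = (eps x : K) * (eps y : K).
Proof. by rewrite (cm_counit muC) epsTTE. Qed.

(** The product of Tc V \ox Tc V induced by mu, for which Delta is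
    multiplicative [Delta_mu]. *)
Definition mu2 (X Y : TT) : TT := tmap 0 mu mu (swap23 T T T T (X \ox Y)).

Lemma Delta_mu x y : Delta (mu (x \ox y)) = mu2 (Delta x) (Delta y).
Proof. by rewrite (cm_comult muC) DeltaTTE. Qed.

Lemma mu2_linearl Y : linear (mu2^~ Y).
Proof. by move=> k x y; rewrite /mu2 tens_linearl !linearP. Qed.

Lemma mu2_linearr X : linear (mu2 X).
Proof. by move=> k x y; rewrite /mu2 tens_linearr !linearP. Qed.

Lemma mu2_homog i j a b c d : homog i b -> homog j c ->
  mu2 (a \ox b) (c \ox d) = ksign K (i * j) *: (mu (a \ox c) \ox mu (b \ox d)).
Proof.
move=> hb hc; rewrite /mu2 (swap23_homog _ _ hb hc) linearZ /=.
by rewrite tmap0E.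
Qed.

Lemma mu2_dsum (S R : splitting K) (i : S) (j : R)
    (A B : S -> T) (A' B' : R -> T) :
    (forall b, homog (dg b) (B b)) -> (forall c, homog (dg c) (A' c)) ->
  mu2 (dsum (splits i) (fun a b => A a \ox B b))
      (dsum (splits j) (fun c d => A' c \ox B' d)) =
  dsum (splits i) (fun a b => dsum (splits j) (fun c d =>
    ksign K (dg b * dg c) *: (mu (A a \ox A' c) \ox mu (B b \ox B' d)))).
Proof.
move=> hB hA'; rewrite /mu2 swap23_dsum // (dsum_lin _ _ (linearP _)).
apply: eq_dsum => a b; rewrite (dsum_lin _ _ (linearP _)).
by apply: eq_dsum => c d; rewrite linearZ /= tmap0E.
Qed.

Lemma left_unit_coalgebra_map :
  @coalgebra_map K V T Delta eps (fun x => mu (Tc1 V \ox x)).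
Proof.
have L : linear (fun x => mu (Tc1 V \ox x)).
  by move=> k y z; rewrite tens_linearr muL.
split=> [//|n x hx|x|x].
- by rewrite addr0 -[n]add0r; apply: mu_homog => //; apply: Tc1_homog.
- rewrite Delta_mu Delta_Tc1; move: (Delta x).
  apply: (tensor_ext (f := mu2 (Tc1 V \ox Tc1 V))) => [||a b].
  + exact: mu2_linearr.
  + exact: linearP.
  rewrite tmap0E //; elim/homog_ind: a => [|y z Ey Ez|n y hy].
  + by rewrite tens0l (lin0 (mu2_linearr _)) tens0r (lin0 muL) tens0l.
  + by rewrite tensDl (linD (mu2_linearr _)) Ey Ez tensDr (linD muL) tensDl.
  by rewrite (mu2_homog _ _ (Tc1_homog V) hy) mul0r ksign0 scale1r.
- by rewrite eps_mu eps_Tc1 mul1r.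
Qed.

Lemma right_unit_coalgebra_map :
  @coalgebra_map K V T Delta eps (fun x => mu (x \ox Tc1 V)).
Proof.
have L : linear (fun x => mu (x \ox Tc1 V)).
  by move=> k y z; rewrite tens_linearl muL.
split=> [//|n x hx|x|x].
- by apply: mu_homog => //; apply: Tc1_homog.
- rewrite Delta_mu Delta_Tc1; move: (Delta x).
  apply: (tensor_ext (f := mu2^~ (Tc1 V \ox Tc1 V))) => [||a b].
  + exact: mu2_linearl.
  + exact: linearP.
  rewrite tmap0E //; elim/homog_ind: b => [|y z Ey Ez|n y hy].
  + by rewrite tens0r (lin0 (mu2_linearl _)) tens0l (lin0 muL) tens0r.
  + by rewrite tensDr (linD (mu2_linearl _)) Ey Ez tensDl (linD muL) tensDr.
  by rewrite (mu2_homog _ _ hy (Tc1_homog V)) mulr0 ksign0 scale1r.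
- by rewrite eps_mu eps_Tc1 mulr1.
Qed.

End Products.

(** * Coderivations *)

Record coderivation (d : T -> T) : Prop := {
  cd_linear : linear d;
  cd_degree : has_degree (-1) d;
  cd_coder : forall x,
    Delta (d x) = tmap 0 d id (Delta x) + tmap (-1) id d (Delta x)
}.

Let id_linear (A : lmodType K) : linear (@id A).
Proof. by []. Qed.

Lemma tmapN1_homog (d : T -> T) n (a b : T) : linear d -> homog n a ->
  tmap (-1) id d (a \ox b) = ksign K n *: (a \ox d b) :> TT.
Proof.
move=> dL ha; rewrite (tmap_homog (-1) b (@id_linear T) dL ha); congr (_ *: _).
by apply: (@ksign_parity _ (- n)); ring.
Qed.

Lemma coder_dsum (S : splitting K) (i : S) (A B : S -> T) (d : T -> T) :
    linear d -> (forall a, homog (dg a) (A a)) ->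
  let X : TT := dsum (splits i) (fun a b => A a \ox B b) in
  tmap 0 d id X + tmap (-1) id d X =
  dsum (splits i) (fun a b =>
    d (A a) \ox B b + ksign K (dg a) *: (A a \ox d (B b))).
Proof.
move=> dL hA X; rewrite /X !(dsum_lin _ _ (linearP _)) -dsumD.
by apply: eq_dsum => a b; rewrite tmap0E // (tmapN1_homog _ dL (hA a)).
Qed.

Lemma coderivation_hword (d : T -> T) : linear d ->
    (forall w : W, homog (dg w - 1) (d (hword w))) ->
    (forall w : W, Delta (d (hword w)) = dsum (splits w) (fun a b =>
      d (hword a) \ox hword b + ksign K (dg a) *: (hword a \ox d (hword b)))) ->
  coderivation d.
Proof.
move=> dL dh dD; split=> // [|x]; first exact: (vec_degree Tc_presented).
move: x; apply: (vec_ext Tc_presented) => [k x y|k x y|w].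
- by rewrite dL linearP.
- by rewrite !linearP scalerDr addrACA.
rewrite dD Delta_hword (coder_dsum (S := W)) //; exact: hword_homog.
Qed.

Section CoderivationTheory.
Variable d : T -> T.
Hypothesis dC : coderivation d.

Let dL := cd_linear dC.

Lemma coder_hword (w : W) : Delta (d (hword w)) = dsum (splits w) (fun a b =>
  d (hword a) \ox hword b + ksign K (dg a) *: (hword a \ox d (hword b))).
Proof.
rewrite (cd_coder dC) Delta_hword (coder_dsum (S := W)) //; exact: hword_homog.
Qed.

Lemma epsTT_Delta (x : T) : epsTT (Delta x) = eps x.
Proof.
have L := epsTT_linear.
move: x; apply: (vec_ext Tc_presented (M := K^o)) => [k x y|k x y|w].
- by rewrite (linearP Delta) L.
- by rewrite linearP.
rewrite Delta_hword (dsum_lin _ _ L) eps_hword.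
rewrite -[RHS](dsum_counitl (s := W) (fun b => (size b == 0%N)%:R : K^o)).
apply: eq_dsum => a b; rewrite epsTTE !eps_hword /=.
by case: eqP => _; rewrite ?mul1r ?mul0r.
Qed.

(** Applying eps \ox eps to the coderivation rule gives
    eps (d x) = eps (d x) + eps (d x). *)
Lemma eps_coder x : eps (d x) = 0.
Proof.
move: x; apply: (vec_ext Tc_presented) => [k x y|k x y|w].
- by rewrite dL linearP.
- by rewrite scaler0 addr0.
have L := epsTT_linear.
have := epsTT_Delta (d (hword w)); rewrite coder_hword (dsum_lin _ _ L).
have -> : dsum (splits w) (fun a b : W => epsTT (d (hword a) \ox hword b +
     ksign K (dg a) *: (hword a \ox d (hword b))) : K^o) =
   (eps (d (hword w)) : K) + (eps (d (hword w)) : K).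
  rewrite -{1}(dsum_counitr (s := W) (fun a => eps (d (hword a)))).
  rewrite -[X in _ = _ + X](dsum_counitl (s := W)
    (fun b => eps (d (hword b)))) -dsumD.
  apply: eq_dsum => a b; rewrite (linD L) (linZ L) !epsTTE !eps_hword /=.
  congr (_ + _); first by case: eqP; rewrite ?mulr1 ?mulr0.
  case: eqP => [/wdeg_size0 ->|_]; last by rewrite mul0r scaler0.
  by rewrite ksign0 scale1r mul1r.
by move/(canRL (addrK _)); rewrite subrr.
Qed.

End CoderivationTheory.

Section Extension.
Variable f : V -> V.
Hypothesis fL : linear f.
Hypothesis fd : has_degree (-1) f.

(** The operator koszul (-1) is v |-> (-1)^|v| v, the sign of moving f past the
    first letter. *)
Fixpoint coext_word (w : seq V) : T :=
  if w is v :: w' then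
    tcons (f v) (word w') + tcons (koszul (-1) v) (coext_word w')
  else 0.

Definition coext : {linear T -> T} := wlift coext_word.

Lemma coext_wordE w : coext (word w) = coext_word w.
Proof.
apply: wliftE => {w} w1; elim: w1 => [|v w1 IH] w2 k x y /=.
  by rewrite fL koszul_linear !tcons_linear scalerDr addrACA.
by rewrite IH word_multilinear !linearP scalerDr addrACA.
Qed.

Lemma coext_cons l w : coext (hword (l :: w)) =
  tcons (f (lval l)) (hword w) +
  ksign K (ldeg l) *: tcons (lval l) (coext (hword w)).
Proof.
rewrite /hword coext_wordE /= coext_wordE (koszul_homog _ (lvalP l)).
rewrite (linZ (tcons_linear _)); congr (_ + _ *: _).
by apply: (@ksign_parity _ (- ldeg l)); ring.
Qed.

Lemma coext_nil : coext (Tc1 V) = 0.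
Proof. exact: (coext_wordE [::]). Qed.

Lemma coext_coderivation : coderivation coext.
Proof.
apply: coderivation_hword => [|w|w]; first exact: linearP.
  elim: w => [|l w IH].
    by rewrite [hword _]/(Tc1 V) coext_nil; apply: homog0.
  rewrite coext_cons /= /wdeg big_cons -/(wdeg w); apply: homogD.
    rewrite addrAC; apply: tcons_homog; last exact: hword_homog.
    by apply: fd; apply: lvalP.
  by apply: homogZ; rewrite -addrA; apply: tcons_homog => //; apply: lvalP.
elim: w => [|l w IH].
  rewrite /= dsum_nil [hword _]/(Tc1 V) coext_nil linear0 tens0l tens0r.
  by rewrite scaler0 addr0.
rewrite /= dsum_cons coext_cons linearD linearZ /= !Delta_tcons IH Delta_hword.
rewrite [hword [::]]/(Tc1 V) coext_nil tens0l add0r [wdeg [::]]big_nil ksign0.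
rewrite scale1r tensDr tensZr scalerDr addrACA; congr (_ + _).
rewrite !(dsum_lin _ _ (linearP (consl _))) -dsumZ -dsumD.
apply: eq_dsum => a b; rewrite coext_cons linearD linearZ /= !conslE tensDl.
rewrite tensZl hword_cons scalerDr scalerA addrA; congr (_ + _).
by rewrite /wdeg big_cons ksignD.
Qed.

Lemma pr1_coext x : pr1 (coext x) = f (pr1 x).
Proof.
move: x; apply: (vec_ext Tc_presented) => [||w]; first exact: linear_comp.
  by move=> k x y; rewrite linearP fL.
case: w => [|l w].
  by rewrite [hword _]/(Tc1 V) coext_nil linear0 pr1_Tc1 (lin0 fL).
rewrite coext_cons linearD linearZ /= hword_cons !pr1_tcons.
rewrite (eps_coder coext_coderivation).
by rewrite scale0r scaler0 addr0 (linZ fL).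
Qed.

End Extension.
End TensorCoalgebras.

Section TwoAssociative.
Variables (K : fieldType) (V : gradedModType K).
Variables (dot odot : V -> V -> V) (one : V) (del : V -> V).
Hypothesis HV : two_assoc_dga dot odot one del.
Local Notation T := (Tc V).
Local Notation TT := (tensor (Tc V) (Tc V)).
Local Notation W := (words V).
Local Notation WW := (prod_splitting (words V) (words V)).

Let odotB := odot_bilinear HV.
Let odotA := odot_assoc HV.
Let dotB := dot_bilinear HV.
Let delL := del_linear HV.
Let odotl y : linear (odot^~ y). Proof. exact: odotB.1. Qed.
Let odotr x : linear (odot x). Proof. exact: odotB.2. Qed.
Let dotl y : linear (dot^~ y). Proof. exact: dotB.1. Qed.
Let dotr x : linear (dot x). Proof. exact: dotB.2. Qed.

(** * The augmented product of letters *)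

(** Extending tau1 by sending the empty word to the unit makes the compatibility
    conditions hold without restriction to the kernel of eps. *)
Definition utau (x : T) : V := (eps x : K) *: one + tau1 odot x.

Lemma utau_linear : linear utau.
Proof.
move=> k x y; rewrite /utau eps_linear linearP scalerDl scalerDr scalerA.
exact: addrACA.
Qed.

Lemma utau_tcons v x : utau (tcons v x) = odot v (utau x).
Proof.
rewrite /utau eps_tcons scale0r add0r tau1_tcons // (linD (odotr v)).
by rewrite (linZ (odotr v)) (odot_unitr HV).
Qed.

Lemma utau_Tc1 : utau (Tc1 V) = one.
Proof. by rewrite /utau eps_Tc1 scale1r tau1_Tc1 // addr0. Qed.

Lemma utau_eps0 x : eps x = 0 -> utau x = tau1 odot x.
Proof. by move=> x0; rewrite /utau x0 scale0r add0r. Qed.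

Lemma utau_hword_homog (w : W) : homog (dg w) (utau (hword w)).
Proof.
elim: w => [|l w IH] /=.
  by rewrite [hword _]/(Tc1 V) utau_Tc1 /wdeg big_nil; apply: one_degree HV.
rewrite hword_cons utau_tcons /wdeg big_cons; apply: (odot_degree HV) => //.
exact: lvalP.
Qed.

Lemma tau1_degree : has_degree 0 (tau1 odot).
Proof.
apply: (vec_degree (Tc_presented V)) => [|w]; first exact: linearP.
rewrite addr0; have [w0|nw] := eqVneq (size w) 0%N.
  move: w0; case: w => // _.
  by rewrite [hword _]/(Tc1 V) tau1_Tc1 //; apply: homog0.
rewrite -utau_eps0; first exact: utau_hword_homog.
by rewrite eps_hword (negPf nw).
Qed.

(** * Straightening tau1 *)

(** The iterated products of the opposite of odot are the alternating ones,
    so the component of sigma is again of the form tau1. *)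
Let oppodot (x y : V) : V := - odot x y.

Let oppodotB : bilinear2 oppodot.
Proof.
by split=> [y|x] k u v; rewrite /oppodot (odotl, odotr) opprD scalerN.
Qed.

Let oppodotA : associative oppodot.
Proof.
move=> x y z; rewrite /oppodot -!scaleN1r (linZ (odotr _)) (linZ (odotl _)).
by rewrite odotA.
Qed.

Let convB : bilinear2 (fun a b : T => odot (pr1 a) (tau1 odot b)).
Proof. by split=> [b|a] k y z; rewrite linearP (odotl, odotr). Qed.

(** The map tau1 solves an equation of the form t = pr1 + pr1 * t for the
    convolution product; composing it with a coalgebra map then expresses the
    result through the component of that map. *)
Lemma tau1_decomposition x : tau1 odot x = pr1 x +
  lift2 (fun a b => odot (pr1 a) (tau1 odot b)) (Delta x).
Proof.
rewrite {1}(Tc_decomposition x) !linearD linearZ /= tau1_Tc1 // scaler0 add0r.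
rewrite tau1_tcons // eps_Tc1 scale1r tau1_Tc1 // (lin0 (odotr _)) addr0.
congr (_ + _); move: (Delta x); apply: tensor_ext => [||a b].
- exact: linear_comp.
- exact: linearP.
rewrite unshiftE lift2E // tau1_tcons // eps_aug scale0r add0r.
by rewrite /aug linearB linearZ /= tau1_Tc1 // scaler0 subr0.
Qed.

(** Since pr1 keeps only the cut before the last letter of w = u v, the left
    side is the alternating product of u times v, that is, minus the
    alternating product of w. The term pr1 (hword w) corrects the case of a
    single letter. *)
Lemma alternating_sum (w : W) : dsum (splits w) (fun a b =>
    odot (tau1 oppodot (hword a)) (pr1 (hword b))) =
  pr1 (hword w) - tau1 oppodot (hword w).
Proof.
elim: w => [|l w IH] /=.
  by rewrite dsum_nil [hword _]/(Tc1 V) pr1_Tc1 tau1_Tc1 // (lin0 (odotr _)) subrr.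
rewrite dsum_cons [hword [::]]/(Tc1 V) tau1_Tc1 // (lin0 (odotl _)) add0r.
rewrite hword_cons pr1_tcons tau1_tcons // opprD addrA subrr sub0r opprK.
transitivity (odot (lval l) (pr1 (hword w)) -
  odot (lval l) (dsum (wsplits w) (fun a b =>
    odot (tau1 oppodot (hword a)) (pr1 (hword b))))); last first.
  by rewrite IH -(linB (odotr _)) opprB addrC subrK.
rewrite -[X in X - _](wsplits_counitl (fun b => odot (lval l) (pr1 (hword b)))).
rewrite (dsum_lin _ _ (odotr _)) -dsumB; apply: eq_dsum => a b.
rewrite hword_cons tau1_tcons // eps_hword /oppodot (linB (odotl _)) -odotA.
congr (_ - _); rewrite (linZ (odotl _)).
by case: eqP => _; rewrite ?scale1r ?scale0r.
Qed.

(** The component of sigma is the alternating iterated product. By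
    induction tau1 sigma is pr1 on proper right factors, and
    [alternating_sum] then evaluates the convolution. *)
Lemma straightening_exists : exists sigma : T -> T,
  [/\ @coalgebra_map K V T Delta eps sigma, sigma (Tc1 V) = Tc1 V
    & forall x, tau1 odot (sigma x) = pr1 x].
Proof.
have [||sigma [sC s1 sp]] := cofree (Tc_presented V) (phi := tau1 oppodot).
- apply: (vec_degree (Tc_presented V)) => [|w]; first exact: linearP.
  rewrite addr0; elim: w => [|l w IH] /=.
    by rewrite [hword _]/(Tc1 V) tau1_Tc1 //; apply: homog0.
  rewrite hword_cons tau1_tcons // /wdeg big_cons; apply: homogD; last first.
    by apply: homogN; apply: (odot_degree HV) => //; apply: lvalP.
  rewrite eps_hword; case: eqP => [/wdeg_size0|_]; last first.
    by rewrite scale0r; apply: homog0.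
  by rewrite -/(wdeg w) => ->; rewrite addr0; apply: homogZ; apply: lvalP.
- by case=> // _; apply: tau1_Tc1.
exists sigma; split=> [//||]; first exact: (s1 [::]).
have sL := cm_linear sC; apply: (vec_ext (Tc_presented V)) => [k x y||w].
- by rewrite sL linearP.
- exact: linearP.
have [n] := ubnP (wt w); elim: n => // n IH in w *; rewrite ltnS => wn.
rewrite tau1_decomposition sp (cm_vec (Tc_presented V) w sC).
rewrite (dsum_lin _ _ (linearP _)) -[RHS](addrNK (tau1 oppodot (hword w))).
rewrite addrC; congr (_ + _); rewrite -alternating_sum.
apply: eq_splits => a b ab _.
rewrite lift2E // sp; have [a0|na] := eqVneq (wt a) 0%N.
  by move: a0 => /=; case: (a) => // _; rewrite tau1_Tc1 // !(lin0 (odotl _)).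
rewrite IH //.
exact: leq_trans (wt_ltr ab na) wn.
Qed.

(** * Existence *)

(** Composing with sigma converts a prescribed component pr1 into a prescribed
    composite with tau1. The subtracted multiple of one makes phi vanish on
    the unit, as the lift requires. *)
Lemma product_exists : exists mu : TT -> T,
  [/\ coalgebra_map (@DeltaTT K V) (@epsTT K V) mu,
      mu (Tc1 V \ox Tc1 V) = Tc1 V
    & forall x y, utau (mu (x \ox y)) = dot (utau x) (utau y)].
Proof.
have [sigma [sC s1 sp]] := straightening_exists.
pose phi : {linear TT -> V} := lift2 (fun x y =>
  dot (utau x) (utau y) - ((eps x : K) * (eps y : K)) *: one).
have phiE x y : phi (x \ox y) =
    dot (utau x) (utau y) - ((eps x : K) * (eps y : K)) *: one.
  rewrite /phi lift2E //; split=> [{}y|{}x] k u v.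
    rewrite utau_linear dotl eps_linear mulrDl scalerDl scalerBr opprD addrACA.
    by rewrite -mulrA scalerA.
  rewrite utau_linear dotr eps_linear mulrDr scalerDl scalerBr opprD addrACA.
  by rewrite mulrCA scalerA.
have [||Phi [PC P1 Pp]] := cofree (TT_presented V) (phi := phi).
- apply: (vec_degree (TT_presented V)) => [|p]; first exact: linearP.
  rewrite addr0 phiE; apply: homogD.
    by apply: (dot_degree HV); apply: utau_hword_homog.
  apply: homogN; have := e_vec (TT_presented V) p; rewrite epsTTE => ->.
  case: eqP => [/dg_wt0 ->|_]; last by rewrite scale0r; apply: homog0.
  by rewrite scale1r; apply: one_degree HV.
- case=> [[|//] [|//]] _; rewrite phiE [hword _]/(Tc1 V) utau_Tc1 (dot_unitl HV).
  by rewrite eps_Tc1 mulr1 scale1r subrr.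
exists (sigma \o Phi); split=> [||x y].
- exact: comp_coalgebra_map.
- by have /= := P1 ([::], [::]) erefl; rewrite /word_pair /= => ->.
rewrite /utau /= sp Pp phiE (cm_counit sC) (cm_counit PC) epsTTE.
by rewrite addrC subrK.
Qed.

(** As sigma tau = id, conjugating a coderivation by tau and sigma gives a
    coderivation again, and tau1 sigma d' tau = pr1 d' tau = del pr1 tau
    = del tau1. *)
Lemma differential_exists : exists d : T -> T,
  [/\ coderivation d, d (Tc1 V) = 0
    & forall x, tau1 odot (d x) = del (tau1 odot x)].
Proof.
have [sigma [sC s1 sp]] := straightening_exists.
have [||tau [tC t1 tp]] := cofree (Tc_presented V) (phi := tau1 odot).
- exact: tau1_degree.
- by case=> // _; apply: tau1_Tc1.
have tauK x : sigma (tau x) = x.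
  apply: (cofree_unique (Tc_presented V) odotB odotA 
    (comp_coalgebra_map sC tC) (id_coalgebra_map V)).
  - by case=> // _; rewrite /= (t1 [::]).
  - by case.
  by move=> w /=; rewrite sp tp.
have [sL tL] := (cm_linear sC, cm_linear tC).
have [eC eL] := (coext_coderivation delL (del_degree HV), linearP (coext del)).
exists (fun x => sigma (coext del (tau x))); split=> [||x]; last first.
- by rewrite sp pr1_coext ?tp //; apply: del_degree HV.
- by rewrite (t1 [::]) // coext_nil // (lin0 sL).
have th (w : W) : homog (dg w) (tau (hword w)).
  by rewrite -[dg w]addr0; apply: (cm_degree tC); apply: hword_homog.
apply: coderivation_hword => [k x y|w|w]; first by rewrite tL eL sL.
  rewrite -[_ - 1]addr0; apply: (cm_degree sC); apply: (cd_degree eC).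
  exact: th.
rewrite (cm_comult sC) (cd_coder eC) (cm_vec (Tc_presented V) w tC).
rewrite (coder_dsum (S := W)) // (dsum_lin _ _ (linearP _)).
apply: eq_dsum => a b.
by rewrite linearD linearZ /= !tmap0E // !tauK.
Qed.

(** * The laws *)

Section Laws.
Variables (mu : TT -> T) (d : T -> T).
Hypothesis muC : coalgebra_map (@DeltaTT K V) (@epsTT K V) mu.
Hypothesis mu_one : mu (Tc1 V \ox Tc1 V) = Tc1 V.
Hypothesis mu_utau : forall x y, utau (mu (x \ox y)) = dot (utau x) (utau y).
Hypothesis dC : coderivation d.
Hypothesis d_one : d (Tc1 V) = 0.
Hypothesis d_tau1 : forall x, tau1 odot (d x) = del (tau1 odot x).

Let muL := cm_linear muC.
Let dL := cd_linear dC.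

(** Leibniz rule for one = dot one one. *)
Let del_one : del one = 0.
Proof.
have := del_derivation HV one (one_degree HV).
rewrite (dot_unitl HV) (dot_unitr HV) (dot_unitl HV) expr0z scale1r.
by move/esym/(canRL (addrK _)); rewrite subrr.
Qed.

Lemma d_utau x : utau (d x) = del (utau x).
Proof.
rewrite utau_eps0 ?(eps_coder dC) // d_tau1 /utau.
by rewrite (linD delL) (linZ delL) del_one scaler0 add0r.
Qed.

Let eps0_tau1 x y :
  eps x = eps y -> utau x = utau y -> tau1 odot x = tau1 odot y.
Proof. by rewrite /utau => -> /addrI. Qed.

Lemma product_unitl x : mu (Tc1 V \ox x) = x.
Proof.
apply: (cofree_unique (Tc_presented V) odotB odotA
  (left_unit_coalgebra_map muC) (id_coalgebra_map V)).
- by case.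
- by case.
move=> w; apply: eps0_tau1; first by rewrite (eps_mu muC) eps_Tc1 mul1r.
by rewrite mu_utau utau_Tc1 (dot_unitl HV).
Qed.

Lemma product_unitr x : mu (x \ox Tc1 V) = x.
Proof.
apply: (cofree_unique (Tc_presented V) odotB odotA
  (right_unit_coalgebra_map muC) (id_coalgebra_map V)).
- by case.
- by case.
move=> w; apply: eps0_tau1; first by rewrite (eps_mu muC) eps_Tc1 mulr1.
by rewrite mu_utau utau_Tc1 (dot_unitr HV).
Qed.

Let pair_homog (p : WW) : homog (dg p) (mu (word_pair p)).
Proof. by apply: (mu_homog muC); apply: hword_homog. Qed.

(** Both sides are coalgebra maps on triples of words. The splitting of triples
    is associated to the left; for the right-hand side it has to be compared
    with the other association, which amounts to equality of the signs. *)
Lemma product_assoc x y z :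
  mu (mu (x \ox y) \ox z) = mu (x \ox mu (y \ox z)).
Proof.
pose f (p : prod_splitting WW W) := mu (mu (word_pair p.1) \ox hword p.2).
pose g (p : prod_splitting WW W) :=
  mu (hword p.1.1 \ox mu (word_pair (p.1.2, p.2))).
have fD p : Delta (f p) = dsum (splits p) (fun a b => f a \ox f b).
  case: p => p w; rewrite (Delta_mu muC) (cm_vec (TT_presented V) p muC).
  rewrite Delta_hword (mu2_dsum muC (S := WW) (R := W)) => [|b|c].
  - by rewrite [RHS]dsum_prod.
  - exact: pair_homog.
  - exact: hword_homog.
have gD p : Delta (g p) = dsum (splits p) (fun a b => g a \ox g b).
  case: p => [[u v] w].
  rewrite (Delta_mu muC) (cm_vec (TT_presented V) (v, w) muC).
  rewrite Delta_hword (mu2_dsum muC (S := W) (R := WW)); last 2 first.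
  - exact: hword_homog.
  - exact: pair_homog.
  rewrite [RHS]dsum_prod [RHS]dsum_prod; apply: eq_dsum => a b.
  rewrite dsum_prod; apply: eq_dsum => a' b'.
  rewrite -!dsumZ; apply: eq_dsum => c c'.
  rewrite !scalerA -!ksignD; congr (ksign K _ *: _).
  by rewrite /= /prod_dg /=; ring.
have fg p : f p = g p.
  apply/eqP; rewrite -subr_eq0; apply/eqP; move: p.
  apply: (@vanishing _ _ _ _ odotB odotA _ f g) => [p|p|p|p|p|p].
  - rewrite linearB fD gD -dsumB; apply: eq_dsum => a b.
    by rewrite tensBl tensBr addrA subrK.
  - by rewrite linearB /= !(eps_mu muC) mulrA subrr.
  - rewrite linearB /=; apply/eqP; rewrite subr_eq0; apply/eqP.
    apply: eps0_tau1.
      by rewrite !(eps_mu muC) mulrA.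
    by rewrite !mu_utau (dot_assoc HV).
  - case: p => [[[|//] [|//]] [|//]] _.
    by rewrite /f /g /word_pair /= [hword _]/(Tc1 V) !mu_one subrr.
  - case: p => [[[|//] [|//]] [|//]] _.
    by rewrite /f /word_pair /= [hword _]/(Tc1 V) !mu_one aug_Tc1.
  - case: p => [[[|//] [|//]] [|//]] _.
    by rewrite /g /word_pair /= [hword _]/(Tc1 V) !mu_one pr1_Tc1.
move: x; apply: (vec_ext (Tc_presented V)) => [k a b|k a b|u].
- by rewrite tens_linearl muL tens_linearl muL.
- by rewrite tens_linearl muL.
move: y; apply: (vec_ext (Tc_presented V)) => [k a b|k a b|v].
- by rewrite tens_linearr muL tens_linearl muL.
- by rewrite tens_linearl muL tens_linearr muL.
move: z; apply: (vec_ext (Tc_presented V)) => [k a b|k a b|w].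
- by rewrite tens_linearr muL.
- by rewrite tens_linearr muL tens_linearr muL.
exact: (fg ((u, v), w)).
Qed.

(** The square of an odd coderivation is a coderivation: the two mixed terms
    have opposite signs. *)
Lemma differential_square x : d (d x) = 0.
Proof.
move: x; apply: (vec_ext (Tc_presented V)) => [k a b|k a b|w].
- by rewrite !dL.
- by rewrite scaler0 addr0.
move: w; apply: (@vanishing _ _ W _ odotB odotA _ (@hword K V) (@hword K V)).
- move=> w; rewrite (cd_coder dC) (coder_hword dC).
  rewrite !(dsum_lin _ _ (linearP _)) -dsumD.
  apply: eq_dsum => a b.
  have ha : homog (dg a) (hword a) by apply: hword_homog.
  have hda : homog (dg a - 1) (d (hword a)) by apply: (cd_degree dC).
  rewrite !linearD !linearZ /= !tmap0E //.
  rewrite (tmapN1_homog _ dL ha) (tmapN1_homog _ dL hda) scalerA ksign_sqr scale1r.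
  by rewrite ksignD ksignN1 mulrN1 scaleNr addrA addrK.
- by move=> w; apply: eps_coder dC _.
- by move=> w; rewrite !d_tau1 (del_square HV).
- by case=> // _; rewrite [hword _]/(Tc1 V) !d_one (lin0 dL).
- by case=> // _; apply: aug_Tc1.
- by case=> // _; apply: pr1_Tc1.
Qed.

(** The difference of the two sides is a coderivation along mu, and utau of it
    is the Leibniz rule of del. *)
Lemma differential_product x :
  d (mu x) = mu (tmap 0 d id x + tmap (-1) id d x).
Proof.
move: x; apply: (vec_ext (TT_presented V)) => [k a b|k a b|p].
- by rewrite muL dL.
- by rewrite -muL; congr mu; rewrite !linearP scalerDr addrACA.
pose D (p : WW) := mu (d (hword p.1) \ox hword p.2)
  + ksign K (dg p.1) *: mu (hword p.1 \ox d (hword p.2)).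
have -> : mu (tmap 0 d id (word_pair p) + tmap (-1) id d (word_pair p)) = D p.
  rewrite /word_pair tmap0E // (tmapN1_homog _ dL (hword_homog p.1)).
  by rewrite (linD muL) (linZ muL).
apply/eqP; rewrite -subr_eq0; apply/eqP; move: p.
apply: (@vanishing _ _ WW _ odotB odotA _ (fun p => mu (word_pair p))
   (fun p => ksign K (dg p) *: mu (word_pair p))).
- case=> u v; rewrite [RHS]dsum_prod linearB (cd_coder dC).
  rewrite (cm_vec (TT_presented V) (u, v) muC).
  rewrite (coder_dsum (S := WW)) // dsum_prod linearD linearZ /= !(Delta_mu muC).
  rewrite !(coder_hword dC) !Delta_hword /=.
  rewrite !(dsum_lin _ _ (mu2_linearl _ _)) -dsumZ -dsumD -dsumB.
  apply: (@eq_splits _ W _ u) => a b _ /= <-.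
  rewrite !(dsum_lin _ _ (mu2_linearr _ _)) -dsumZ -dsumD -dsumB.
  apply: eq_dsum => a' b'.
  have hb := hword_homog b; have ha' := hword_homog a'.
  have hdb : homog (wdeg b - 1) (d (hword b)) by apply: (cd_degree dC).
  have hda' : homog (wdeg a' - 1) (d (hword a')) by apply: (cd_degree dC).
  rewrite (linD (mu2_linearl _ _)) (linZ (mu2_linearl _ _)).
  rewrite (linD (mu2_linearr _ _)) (linZ (mu2_linearr _ _)).
  rewrite !(mu2_homog muC _ _ hb ha') (mu2_homog muC _ _ hdb ha').
  rewrite (mu2_homog muC _ _ hb hda').
  rewrite /D /= !tensBl !tensDl !tensBr !tensDr !tensZl !tensZr.
  rewrite !(scalerA, scalerDr, scalerN) -!ksignD.
  rewrite [X in _ - X = _]addrACA opprD addrACA.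
  (* The remaining goals compare the signs of mu (a \ox d a') \ox mu (b \ox b'),
     mu (a \ox a') \ox mu (d b \ox b') and mu (a \ox a') \ox mu (b \ox d b'). *)
  congr (_ - (_ + _ *: _) + (_ - (_ *: _ + _ *: _)));
    rewrite /prod_dg /= -?addrA.
  - by apply: (@ksign_parity _ 0); ring.
  - by apply: (@ksign_parity _ (- wdeg a')); ring.
  - by apply: (@ksign_parity _ 0); ring.
- move=> p; rewrite linearB /= (eps_coder dC) linearD linearZ /= !(eps_mu muC).
  by rewrite !(eps_coder dC) mul0r mulr0 scaler0 addr0 subrr.
- move=> p; rewrite linearB /=; apply/eqP; rewrite subr_eq0; apply/eqP.
  apply: eps0_tau1.
    rewrite (eps_coder dC) linearD linearZ /= !(eps_mu muC).
    by rewrite !(eps_coder dC) mul0r mulr0 scaler0 addr0.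
  rewrite d_utau mu_utau (linD utau_linear) (linZ utau_linear) !mu_utau !d_utau.
  by rewrite (del_derivation HV _ (utau_hword_homog p.1)).
- case=> [[|//] [|//]] _; rewrite /D /word_pair /= [hword _]/(Tc1 V) mu_one d_one.
  by rewrite tens0l tens0r (lin0 muL) scaler0 addr0 subrr.
- case=> [[|//] [|//]] _.
  by rewrite /word_pair /= [hword _]/(Tc1 V) mu_one aug_Tc1.
- case=> [[|//] [|//]] _.
  by rewrite linearZ /= /word_pair /= [hword _]/(Tc1 V) mu_one pr1_Tc1 scaler0.
Qed.

End Laws.

(** * Uniqueness of the structure *)

Section Uniqueness.
Variables (mu mu' : TT -> T) (d d' : T -> T).
Hypotheses (B : Binfty mu d) (B' : Binfty mu' d').

Lemma binfty_coalgebra_map (nu : TT -> T) (e : T -> T) :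
  Binfty nu e -> coalgebra_map (@DeltaTT K V) (@epsTT K V) nu.
Proof. by case. Qed.

Lemma binfty_coderivation (nu : TT -> T) (e : T -> T) :
  Binfty nu e -> coderivation e.
Proof. by case. Qed.

(** The hypothesis leaves out pairs with an empty word, where both products are
    given by the unit laws. *)
Lemma product_unique :
    (forall x y, eps x = 0 -> eps y = 0 ->
       tau1 odot (mu (x \ox y)) = tau1 odot (mu' (x \ox y))) ->
  mu =1 mu'.
Proof.
move=> E; apply: (cofree_unique (TT_presented V) odotB odotA
  (binfty_coalgebra_map B) (binfty_coalgebra_map B')).
- by case=> [[|//] [|//]] _; apply: mu_unitl B _.
- by case=> [[|//] [|//]] _; apply: mu_unitl B' _.
case=> [[|l u] [|l' v]]; rewrite /word_pair /=.
- by rewrite (mu_unitl B) (mu_unitl B').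
- by rewrite (mu_unitl B) (mu_unitl B').
- by rewrite (mu_unitr B) (mu_unitr B').
by apply: E; rewrite eps_hword.
Qed.

Lemma differential_unique :
    (forall x, eps x = 0 -> tau1 odot (d x) = tau1 odot (d' x)) ->
  d =1 d'.
Proof.
have [dC dC'] := (binfty_coderivation B, binfty_coderivation B').
move=> E; apply: (vec_ext (Tc_presented V) (d_linear B) (d_linear B')) => w.
apply/eqP; rewrite -subr_eq0; apply/eqP; move: w.
apply: (@vanishing _ _ W _ odotB odotA _ (@hword K V)
  (fun w => ksign K (dg w) *: hword w)).
- move=> w; rewrite linearB (coder_hword dC) (coder_hword dC') -dsumB.
  apply: eq_dsum => a b; rewrite tensBl tensBr !tensZl opprD.
  by rewrite addrACA.
- by move=> w; rewrite linearB (eps_coder dC) (eps_coder dC') subrr.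
- case=> [|l w].
    by rewrite [hword _]/(Tc1 V) (d_unit B) (d_unit B') subrr linear0.
  by rewrite linearB /= E ?subrr // eps_hword.
- by case=> // _; rewrite [hword _]/(Tc1 V) (d_unit B) (d_unit B') subrr.
- by case=> // _; apply: aug_Tc1.
- by case=> // _; rewrite linearZ /= [hword _]/(Tc1 V) pr1_Tc1 scaler0.
Qed.

End Uniqueness.
End TwoAssociative.

Theorem theorem3p1p2 (K : fieldType) (V : gradedModType K)
    (dot odot : V -> V -> V) (one : V) (del : V -> V)
    (HV : two_assoc_dga dot odot one del) :
  exists! md : (tensor (Tc V) (Tc V) -> Tc V) * (Tc V -> Tc V),
    [/\ Binfty md.1 md.2,
        forall x y : Tc V, eps x = 0 -> eps y = 0 ->
          tau1 odot (md.1 (x \ox y)) = dot (tau1 odot x) (tau1 odot y)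
      & forall x : Tc V, eps x = 0 ->
          tau1 odot (md.2 x) = del (tau1 odot x)].
Proof.
have [mu [muC mu1 mul]] := product_exists HV.
have [d [dC d1 dt]] := differential_exists HV.
have mut (x y : Tc V) : eps x = 0 -> eps y = 0 ->
    tau1 odot (mu (x \ox y)) = dot (tau1 odot x) (tau1 odot y).
  move=> x0 y0; rewrite -(utau_eps0 odot one) ?mul ?utau_eps0 //.
  by rewrite (eps_mu muC) x0 mul0r.
have B : Binfty mu d.
  split.
  - exact: cm_linear muC.
  - exact: cm_degree muC.
  - exact: cm_comult muC.
  - exact: cm_counit muC.
  - exact: (product_assoc HV muC mu1 mul).
  - exact: (product_unitl HV muC mu1 mul).
  - exact: (product_unitr HV muC mu1 mul).
  - exact: cd_linear dC.
  - exact: cd_degree dC.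
  - exact: cd_coder dC.
  - exact: d1.
  - exact: (differential_square HV dC d1 dt).
  - exact: (differential_product HV muC mu1 mul dC d1 dt).
exists (mu, d); split=> [|[mu' d'] /= [B' mut' dt']]; first by split.
congr pair; apply/funext => x.
  by apply: (product_unique HV B B') => y z y0 z0; rewrite mut // mut'.
by apply: (differential_unique HV B B') => y y0; rewrite dt dt'.
Qed.
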